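(* Let $R$ be a Dubrovin valuation ring of a simple Artinian ring $A$, with $P=J(R)$, and suppose $\bigcap_{n\geq 1} P^{n}=0$. For $I\in\mathcal{F}(R)$ put $v(I)=\{a\in A\mid aI\subseteq P\}$ and let $\Gamma=\{v(I)\mid I\in\mathcal{F}(R)\}$. Then $v:\mathcal{F}(R)\to\Gamma$ is an arithmetical pseudo-valuation, $\Gamma$ is a totally ordered group, and $$P=\{a\in A\mid v(RaR)>0\},\qquad R=\{a\in A\mid v(RaR)\geq 0\}.$$
   Context: A Dubrovin valuation ring of a simple Artinian ring $A$ is a subring $R$ of $A$ such that $R/J(R)$ is simple Artinian ($J(R)$ the Jacobson radical) and for every $q\in A\setminus R$ there are $r,r'\in R$ with $rq\in R\setminus J(R)$ and $qr'\in R\setminus J(R)$. Such an $R$ is a prime Goldie ring and an order in $A$. A fractional $R$-ideal of $A$ is an $R$-bimodule $I\subseteq A$ which contains a regular element of $R$ and satisfies $rI\subseteq R$ for some regular $r\in R$; $\mathcal{F}(R)$ is the set of fractional $R$-ideals. $\Gamma$ is given the operation $v(I)+v(J)=v(IJ)$, with neutral element $0=v(R)=P$, and the order $v(I)\leq v(J)\Leftrightarrow v(I)\subseteq v(J)$ (that these make $\Gamma$ a well-defined ordered group is part of the claim). An arithmetical pseudo-valuation on $R$ is a function $v:\mathcal{F}(R)\to\Gamma$, with $\Gamma$ a partially ordered semigroup, such that for all $I,J\in\mathcal{F}(R)$: (1) $v(IJ)=v(I)+v(J)$; (2) $v(I+J)\geq\min\{v(I),v(J)\}$; (3) $v(R)=0$;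 (4) $I\subseteq J$ implies $v(I)\geq v(J)$. By convention, $a=0$ is counted as satisfying $v(RaR)>0$. *)

(* Defs.v *)
From HB Require Import structures.
From mathcomp Require Import all_boot all_algebra.
From mathcomp Require Import boolp classical_sets.

Set Implicit Arguments.
Unset Strict Implicit.
Unset Printing Implicit Defensive.

Import GRing.Theory.
Local Open Scope classical_set_scope.
Local Open Scope ring_scope.

Definition additive_subgroup (V : zmodType) (I : set V) : Prop :=
  I 0 /\ (forall x y, I x -> I y -> I (x - y)).

Definition left_ideal (T : nzRingType) (I : set T) : Prop :=
  additive_subgroup I /\ (forall r x, I x -> I (r * x)).

Definition right_ideal (T : nzRingType) (I : set T) : Prop :=
  additive_subgroup I /\ (forall r x, I x -> I (x * r)).

Definition two_sided_ideal (T : nzRingType) (I : set T) : Prop :=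
  left_ideal I /\ right_ideal I.

Definition simple_ring (T : nzRingType) : Prop :=
  forall I : set T, two_sided_ideal I -> I = [set 0] \/ I = setT.

Definition dcc (T : Type) (C : set T -> Prop) : Prop :=
  forall I : nat -> set T,
    (forall n, C (I n)) -> (forall n, I n.+1 `<=` I n) ->
    exists N, forall n, (N <= n)%N -> I n = I N.

Definition artinian (T : nzRingType) : Prop :=
  dcc (@left_ideal T) /\ dcc (@right_ideal T).

Definition simple_artinian (T : nzRingType) : Prop :=
  simple_ring T /\ artinian T.

Definition maximal_left_ideal (T : nzRingType) (M : set T) : Prop :=
  [/\ left_ideal M, M <> setT &
      forall I : set T, left_ideal I -> M `<=` I -> I = M \/ I = setT].

Definition jacobson_radical (T : nzRingType) : set T :=
  \bigcap_(M in [set M | @maximal_left_ideal T M]) M.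

(* MathComp constructs quotients by an ideal for commutative rings only; here  *)
(* Q is T / J up to isomorphism, given by its canonical projection.            *)
Definition is_quotient_ring (T : nzRingType) (J : set T) (Q : nzRingType) :
    Prop :=
  exists pi : {rmorphism T -> Q},
    (forall y, exists x, pi x = y) /\ [set x | pi x = 0] = J.

Definition regular_elt (T : nzRingType) (c : T) : Prop :=
  GRing.lreg c /\ GRing.rreg c.

Definition subring (A : nzRingType) (R : subringClosed A) : Type :=
  {x : A | x \in R}.

HB.instance Definition _ (A : nzRingType) (R : subringClosed A) :=
  SubChoice.on (subring R).
HB.instance Definition _ (A : nzRingType) (R : subringClosed A) :=
  [SubChoice_isSubNzRing of subring R by <:].

Section DubrovinRing.
Variables (A : nzRingType) (R : subringClosed A).
Implicit Types I J : set A.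

Definition jrad : set A := \val @` @jacobson_radical (subring R).

Definition dubrovin_valuation_ring : Prop :=
  (exists2 Q : nzRingType,
     is_quotient_ring (@jacobson_radical (subring R)) Q & simple_artinian Q) /\
  (forall q : A, q \notin R ->
     (exists2 r, r \in R & r * q \in R /\ ~ jrad (r * q)) /\
     (exists2 r', r' \in R & q * r' \in R /\ ~ jrad (q * r'))).

Definition mul_bimod I J : set A :=
  [set x | exists n (a b : 'I_n -> A),
     [/\ forall k, I (a k), forall k, J (b k) & x = \sum_(k < n) a k * b k]].

Definition add_bimod I J : set A :=
  [set x | exists a b, [/\ I a, J b & x = a + b]].

Definition principal_bimod (a : A) : set A :=
  [set x | exists n (r s : 'I_n -> A),
     [/\ forall k, r k \in R, forall k, s k \in R &
         x = \sum_(k < n) r k * a * s k]].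

(* I ^ n.+1, so that the exponents n >= 1 are those of pow_bimodS I n *)
Definition pow_bimodS I (n : nat) : set A := iter n (mul_bimod I) I.

Definition bimodule I : Prop :=
  additive_subgroup I /\
  (forall r x, r \in R -> I x -> I (r * x) /\ I (x * r)).

Definition fractional_ideal : set (set A) :=
  [set I | [/\ bimodule I,
               exists2 c : subring R, regular_elt c & I (\val c) &
               exists2 r : subring R, regular_elt r &
                 forall x, I x -> \val r * x \in R]].

Definition colonP I : set A := [set a | forall x, I x -> jrad (a * x)].

Definition value_set : set (set A) := colonP @` fractional_ideal.

Definition value_le (g h : value_set) : Prop := \val g `<=` \val h.

Definition value_lt (g h : value_set) : Prop := value_le g h /\ g <> h.

Lemma colonP_value_set (I : fractional_ideal) : colonP (\val I) \in value_set.
Proof. by apply/mem_set; exists (\val I) => //; apply/set_mem/(valP I). Qed.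

Definition value (I : fractional_ideal) : value_set :=
  exist (fun X => X \in value_set) (colonP (\val I)) (colonP_value_set I).

End DubrovinRing.

Definition partial_order (G : Type) (le : G -> G -> Prop) : Prop :=
  [/\ forall x, le x x,
      forall x y, le x y -> le y x -> x = y &
      forall x y z, le x y -> le y z -> le x z].

(* add is not assumed commutative, here and for groups; zero is required to be *)
(* neutral, since v(R) = 0 below has no meaning otherwise.                     *)
Definition po_semigroup (G : Type) (add : G -> G -> G) (zero : G)
    (le : G -> G -> Prop) : Prop :=
  [/\ associative add, left_id zero add, right_id zero add, partial_order le &
      forall x y z, le x y -> le (add x z) (add y z) /\ le (add z x) (add z y)].

Definition totally_ordered_group (G : Type) (add : G -> G -> G) (zero : G)
    (le : G -> G -> Prop) : Prop :=
  [/\ po_semigroup add zero le,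
      forall x, exists y, add x y = zero /\ add y x = zero &
      forall x y, le x y \/ le y x].

(* In a partially ordered G, min(v I, v J) need not exist: condition (2) says  *)
(* that v (I + J) is above every common lower bound of v I and v J, which is   *)
(* v (I + J) >= min(v I, v J) as soon as v I and v J are comparable. That      *)
(* I J, I + J and R belong to F(R) is part of conditions (1), (2) and (3).     *)
Definition arithmetical_pseudo_valuation (A : nzRingType)
    (R : subringClosed A) (G : Type) (add : G -> G -> G) (zero : G)
    (le : G -> G -> Prop) (v : fractional_ideal R -> G) : Prop :=
  po_semigroup add zero le /\
  [/\ forall I J : fractional_ideal R,
        exists2 K : fractional_ideal R,
          \val K = mul_bimod (\val I) (\val J) & v K = add (v I) (v J),
      forall I J : fractional_ideal R,
        exists2 K : fractional_ideal R,
          \val K = add_bimod (\val I) (\val J) &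
          forall g, le g (v I) -> le g (v J) -> le g (v K),
      exists2 K : fractional_ideal R, \val K = [set` R] & v K = zero &
      forall I J : fractional_ideal R, \val I `<=` \val J -> le (v J) (v I)].

(* Main.v *)
(** Let [Q = R / P]. The Dubrovin condition and the chain conditions in [Q] show
    that every [R + x R] is [z R] with [z] a unit of [A], so that [R] satisfies
    the Ore condition. If [P = P^2] then [P = 0] and [R = A]. Otherwise the
    bimodule [P / P^2] contains an element [b + P^2] with zero right annihilator
    in [Q]; then [b] is a unit of [A] and [P = b R = R b]. For a unit [c] of [A]
    in [R], the Ore condition makes the possible kernels of [c] modulo all powers
    of [P] a two-sided ideal of [Q]; it vanishes since [Q] is simple and the
    powers of [P] intersect in [0], and therefore [A] is the union of the
    [b^(-n) R]. So every fractional ideal is [w R = R w] for a unit [w] of [A],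
    and the values form the group of these modules. *)

Require Import Defs.
From mathcomp Require Import all_boot all_algebra.
From mathcomp Require Import boolp classical_sets.

Set Implicit Arguments.
Unset Strict Implicit.
Unset Printing Implicit Defensive.

Import GRing.Theory.
Local Open Scope classical_set_scope.
Local Open Scope ring_scope.

(** The obstacle is that [Q] may have zero divisors: a nonzero residue need not be invertible, so
    one cannot divide by an element of least value as in a valued division ring. Idempotents and
    minimal one-sided ideals of [Q] replace this: they improve the generators of [y R + z R] piece
    by piece, and they assemble [b] from corners of [P / P^2]. That [b + P^2] has zero right
    annihilator makes [b] cancellable, hence invertible, in the Artinian ring [A].

    Separation also enters at points that the overview does not show. If [P = P^2], then [P] lies in
    all its powers, whence [P = 0]. It bounds the power of [b] that can be split off a nonzero
    bimodule. Finally, through the case [P = P^2], it lets [v(I)] determine [I], and the definition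
    of addition rests on this. *)

Lemma dcc_minimal (T : Type) (C S : set T -> Prop) :
  dcc C -> (exists2 X, C X & S X) ->
  exists X, [/\ C X, S X & forall Y, C Y -> S Y -> Y `<=` X -> Y = X].
Proof.
move=> dC [X0 CX0 SX0]; apply: contrapT => nomin.
pose W := {X : set T | C X /\ S X}.
have step (X : W) : exists Y : W, sval Y `<=` sval X /\ sval Y <> sval X.
  case: X => X [CX SX] /=; apply: contrapT => nostep.
  apply: nomin; exists X; split=> // Y CY SY YX.
  apply: contrapT => YneX; apply: nostep.
  by exists (exist _ Y (conj CY SY)).
have [f fP] := choice step.
pose I n := sval (iter n f (exist _ X0 (conj CX0 SX0))).
have [||N stable] := dC I.
- by move=> n; exact: (proj1 (svalP (iter n f _))).
- by move=> n; exact: (fP _).1.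
by apply: (fP (iter N f (exist _ X0 (conj CX0 SX0)))).2; exact: (stable N.+1).
Qed.

(** * Idempotents and units in simple Artinian rings *)

Section Ideals.
Variable T : nzRingType.
Implicit Types (I L : set T) (a b e x y z : T).

Lemma additive0 I : additive_subgroup I -> I 0. Proof. by case. Qed.

Lemma additiveB I x y : additive_subgroup I -> I x -> I y -> I (x - y).
Proof. by case=> _; apply. Qed.

Lemma additiveN I x : additive_subgroup I -> I x -> I (- x).
Proof. by move=> aI Ix; rewrite -sub0r; apply: additiveB => //; case: aI. Qed.

Lemma additiveD I x y : additive_subgroup I -> I x -> I y -> I (x + y).
Proof.
by move=> aI Ix Iy; rewrite -[y]opprK; apply: additiveB => //; exact: additiveN.
Qed.

Lemma additive_sum I n (f : 'I_n -> T) :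
  additive_subgroup I -> (forall k, I (f k)) -> I (\sum_k f k).
Proof.
move=> aI If; apply: (big_ind I) => //; first exact: additive0.
by move=> x y; exact: additiveD.
Qed.

Lemma left_ideal_principal x : left_ideal [set t | exists s, t = s * x].
Proof.
split; first split; first by exists 0; rewrite mul0r.
  by move=> _ _ [s ->] [t ->]; exists (s - t); rewrite mulrBl.
by move=> r _ [s ->]; exists (r * s); rewrite mulrA.
Qed.

Lemma left_ideal_annihilator L x : left_ideal L ->
  left_ideal [set t | L t /\ t * x = 0].
Proof.
move=> [aL mL]; split; first split; first by rewrite /= mul0r; split=> //; case: aL.
  move=> s t [Ls s0] [Lt t0]; split; first exact: additiveB.
  by rewrite mulrBl s0 t0 subr0.
by move=> r s [Ls s0]; split; [exact: mL | rewrite -mulrA s0 mulr0].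
Qed.

Lemma two_sided_ideal_full I : simple_ring T -> two_sided_ideal I ->
  (exists2 x, I x & x <> 0) -> I 1.
Proof.
move=> sT tI [x Ix x0]; case: (sT I tI) => EI; last by rewrite EI.
by move: Ix; rewrite EI => /x0.
Qed.

Hypothesis hT : simple_artinian T.

(** The right annihilator of [a T] is a two-sided ideal, so a nonzero [b] in it would put 1 there as
    well. *)
Lemma simple_prime a b : a <> 0 -> b <> 0 -> exists s, a * s * b <> 0.
Proof.
move=> a0 b0; apply: contrapT => noS; apply: a0.
have ann s : a * s * b = 0 by apply: contrapT => ne; apply: noS; exists s.
have tI : two_sided_ideal [set x | forall s, a * s * x = 0].
  split; split.
  - by split=> [s|x y Hx Hy s]; rewrite ?mulr0// mulrBr Hx Hy subr0.
  - by move=> r x Hx s; rewrite mulrA -[a * s * r]mulrA Hx.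
  - by split=> [s|x y Hx Hy s]; rewrite ?mulr0// mulrBr Hx Hy subr0.
  - by move=> r x Hx s; rewrite mulrA Hx mul0r.
have := two_sided_ideal_full hT.1 tI (ex_intro2 _ _ b ann b0).
by move=> /(_ 1); rewrite !mulr1.
Qed.

Lemma minimal_left_ideal L : left_ideal L -> (exists2 x, L x & x <> 0) ->
  exists M, [/\ left_ideal M, (exists2 x, M x & x <> 0), M `<=` L &
    forall Y, left_ideal Y -> Y `<=` M -> (exists2 x, Y x & x <> 0) -> Y = M].
Proof.
move=> lL nL.
have [|M [lM [nM ML] minM]] := @dcc_minimal T (@left_ideal T)
  (fun X => (exists2 x, X x & x <> 0) /\ X `<=` L) hT.2.1; first by exists L; [|split].
exists M; split=> // Y lY YM nY; apply: minM => //.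
by split=> //; exact: subset_trans YM ML.
Qed.

(** Brauer's lemma. In a minimal left ideal [M], primeness gives an [x] with [M x = M], and by
    minimality no nonzero element of [M] kills [x]. The [e] in [M] with [e x = x] is then
    idempotent. *)
Lemma left_ideal_has_idempotent L : left_ideal L ->
  (exists2 x, L x & x <> 0) -> exists e, [/\ L e, e <> 0 & e * e = e].
Proof.
move=> lL nL; have [M [lM [a Ma a0] ML minM]] := minimal_left_ideal lL nL.
have [s asa] := simple_prime a0 a0.
pose x := s * a; have Mx : M x by exact: lM.2.
have ax0 : a * x <> 0 by rewrite /x mulrA.
have Mxe : [set t | exists2 m, M m & t = m * x] = M.
  apply: minM.
  - split; first split; first by exists 0; rewrite ?mul0r//; exact: additive0 lM.1.
      move=> _ _ [m Mm ->] [m' Mm' ->]; exists (m - m'); last by rewrite mulrBl.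
      exact: (additiveB lM.1).
    by move=> r _ [m Mm ->]; exists (r * m); [exact: lM.2 | rewrite mulrA].
  - by move=> _ [m _ ->]; exact: lM.2.
  - by exists (a * x) => //; exists a.
have [e Me ex] : exists2 e, M e & x = e * x by move: Mx; rewrite -{1}Mxe.
have ann0 m : M m -> m * x = 0 -> m = 0.
  move=> Mm mx; apply: contrapT => m0.
  have E := minM _ (left_ideal_annihilator x lM) (fun t h => h.1)
    (ex_intro2 _ _ m (conj Mm mx) m0).
  by move: Ma; rewrite -E => -[].
exists e; split; first exact: ML.
- by move=> e0; apply: ax0; rewrite ex e0 mul0r mulr0.
- apply/subr0_eq; apply: ann0; first by apply: (additiveB lM.1) => //; apply: lM.2.
  by rewrite mulrBl -mulrA -!ex subrr.
Qed.

Lemma left_ideal_idempotent L : left_ideal L ->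
  exists2 e, L e & forall x, L x -> x * e = x.
Proof.
move=> lL; pose S (X : set T) := exists e, [/\ L e, e * e = e &
  X = [set x | L x /\ x * e = 0]].
have [|X [_ [e [Le ee XE]] minX]] := @dcc_minimal T (@left_ideal T) S hT.2.1.
  exists [set x | L x /\ x * 0 = 0]; first exact: (left_ideal_annihilator 0 lL).
  by exists 0; split=> //; [case: lL.1 | rewrite mul0r].
have X0 x : L x -> x * e = 0 -> x = 0.
  move=> Lx xe; apply: contrapT => x0.
  have lX := left_ideal_annihilator e lL.
  have [f [[Lf fe] f0 ff]] :=
    left_ideal_has_idempotent lX (ex_intro2 _ _ x (conj Lx xe) x0).
  (* [y e' = 0] implies [y e = 0], because [e' e = e]; but [f e = 0] while [f e' = f]. So the
     annihilator of [e'] in [L] is strictly smaller. *)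
  pose e' := e + f - e * f.
  have Le' : L e'.
    by apply: (additiveB lL.1); [exact: (additiveD lL.1) | exact: lL.2].
  have e'e : e' * e = e by rewrite mulrBl mulrDl ee fe -mulrA fe mulr0 addr0 subr0.
  have e'f : e' * f = f by rewrite mulrBl mulrDl -mulrA ff addrAC subrr add0r.
  have e'e' : e' * e' = e'.
    by rewrite {2}/e' mulrBr mulrDr e'e e'f mulrA e'e.
  have E : [set x | L x /\ x * e' = 0] = X.
    apply: minX; [exact: left_ideal_annihilator | by exists e' |].
    move=> y [Ly ye']; rewrite XE; split=> //.
    by rewrite -e'e mulrA ye' mul0r.
  have [_] : [set x | L x /\ x * e' = 0] f by rewrite E XE.
  by rewrite /e' mulrBr mulrDr fe ff mulrA fe mul0r add0r subr0.
exists e => // x Lx; apply/esym/subr0_eq; apply: X0.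
  by apply: (additiveB lL.1) => //; exact: lL.2.
by rewrite mulrBl -mulrA ee subrr.
Qed.

Lemma von_neumann_regular t : exists a, t * a * t = t.
Proof.
have [e [a ->] He] := left_ideal_idempotent (left_ideal_principal t).
by exists a; rewrite -mulrA; apply: He; exists 1; rewrite mul1r.
Qed.

(** The chain of the [T z^n] is stationary from some [N] on, so [z^N = c z^(N+1)], and powers of [z]
    cancel. *)
Lemma rreg_invertible z : (forall x, x * z = 0 -> x = 0) ->
  exists2 c, c * z = 1 & z * c = 1.
Proof.
move=> inj.
have [n|n|N stable] := hT.2.1 (fun n => [set t | exists s, t = s * z ^+ n]).
- exact: left_ideal_principal.
- by move=> _ [s ->]; exists (s * z); rewrite -mulrA -exprS.
have injn n x : x * z ^+ n = 0 -> x = 0.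
  elim: n x => [x|n IHn x]; first by rewrite mulr1.
  by rewrite exprSr mulrA => /inj /IHn.
have : [set t | exists s, t = s * z ^+ N] (z ^+ N) by exists 1; rewrite mul1r.
rewrite -(stable N.+1) // => -[c zN].
have cz : c * z = 1.
  apply/subr0_eq; apply: (injn N).
  by rewrite mulrBl mul1r -mulrA -exprS -zN subrr.
exists c => //; apply/subr0_eq; apply: inj.
by rewrite mulrBl mul1r -mulrA cz mulr1 subrr.
Qed.

Lemma left_inverse_invertible c z : c * z = 1 -> z * c = 1.
Proof.
move=> cz; have [|d dc cd] := @rreg_invertible c.
  by move=> x xc; rewrite -[x]mulr1 -cz mulrA xc mul0r.
by rewrite (_ : z = d) // -[d]mulr1 -cz mulrA dc mul1r.
Qed.

Lemma lreg_invertible z : (forall x, z * x = 0 -> x = 0) ->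
  exists2 c, c * z = 1 & z * c = 1.
Proof.
move=> inj; have [c zcz] := von_neumann_regular z.
have cz : c * z = 1.
  by apply/subr0_eq; apply: inj; rewrite mulrBr mulr1 mulrA zcz subrr.
by exists c => //; exact: left_inverse_invertible.
Qed.

End Ideals.

Section Converse.
Variable T : nzRingType.

Lemma simple_artinian_converse : simple_artinian T -> simple_artinian T^c.
Proof.
move=> [sT [dl dr]]; split; first by move=> I [lI rI]; apply: sT; split.
by split.
Qed.

Hypothesis hT : simple_artinian T.

Lemma right_ideal_idempotent (L : set T) : right_ideal L ->
  exists2 e, L e & forall x, L x -> e * x = x.
Proof. exact: (@left_ideal_idempotent T^c (simple_artinian_converse hT)). Qed.

Lemma minimal_right_ideal (L : set T) : right_ideal L ->
  (exists2 x, L x & x <> 0) ->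
  exists M, [/\ right_ideal M, (exists2 x, M x & x <> 0), M `<=` L &
    forall Y, right_ideal Y -> Y `<=` M -> (exists2 x, Y x & x <> 0) -> Y = M].
Proof. exact: (@minimal_left_ideal T^c (simple_artinian_converse hT)). Qed.

End Converse.

(** * Units congruent to 1 modulo the Jacobson radical *)

Section Jacobson.
Variable T : nzRingType.

Lemma proper_left_ideal_sub_maximal (L : set T) : left_ideal L -> ~ L 1 ->
  exists2 M, maximal_left_ideal M & L `<=` M.
Proof.
move=> lL nL1.
(* The condition bears on the union with [L] so that the empty chain, whose union is empty, also
   satisfies it. *)
pose D (X : set T) := left_ideal (L `|` X) /\ ~ (L `|` X) 1.
have [|M [[lM nM] maxM]] := @Zorn_bigcup T D.
  move=> F FD tF; have [F0|/set0P[X0 FX0]] := eqVneq F set0.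
    by rewrite F0 /D bigcup_set0 setU0.
  have mem2 x y : (L `|` \bigcup_(X in F) X) x -> (L `|` \bigcup_(X in F) X) y ->
      exists X, [/\ F X, (L `|` X) x & (L `|` X) y].
    move=> [Lx|[X FX Xx]] [Ly|[Y FY Yy]].
    - by exists X0; split=> //; left.
    - by exists Y; split=> //; [left|right].
    - by exists X; split=> //; [right|left].
    - case: (tF _ _ FX FY) => h; first by exists Y; split=> //; right => //; exact: h.
      by exists X; split=> //; right => //; exact: h.
  have sub X : F X -> L `|` X `<=` L `|` \bigcup_(X in F) X.
    by move=> FX x [Lx|Xx]; [left|right; exists X].
  split; first split; first split.
  - by left; case: lL.1.
  - move=> x y hx hy; have [X [FX Xx Xy]] := mem2 _ _ hx hy.
    by apply: (sub X) => //; apply: (additiveB (FD X FX).1.1).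
  - move=> r x hx; have [X [FX Xx _]] := mem2 _ _ hx hx.
    by apply: (sub X) => //; apply: (FD X FX).1.2.
  - by move=> h1; have [X [FX X1 _]] := mem2 _ _ h1 h1; apply: (FD X FX).2.
exists (L `|` M); last by move=> x; left.
split=> //; first by move=> E; apply: nM; rewrite E.
move=> I lI LMI; have [I1|nI1] := pselect (I 1).
  by right; apply/seteqP; split=> // x _; rewrite -[x]mulr1; apply: lI.2.
left; apply: contrapT => ne; have LI : L `|` I = I.
  by apply/seteqP; split=> x; [case=> // Lx; apply: LMI; left | right].
apply: (maxM I); last by split; rewrite LI.
split=> [x Mx|IM]; first by apply: LMI; right.
by apply: ne; apply/seteqP; split=> // x /IM; right.
Qed.

Lemma jacobson_left_inverse (x : T) : jacobson_radical x ->
  exists u, u * (1 - x) = 1.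
Proof.
move=> Jx; apply: contrapT => nou.
have [|M MM LM] := proper_left_ideal_sub_maximal (left_ideal_principal (1 - x)).
  by move=> [u u1]; apply: nou; exists u.
have [lM nMT _] := MM; apply: nMT.
have M1 : M 1.
  rewrite -[1](subrK x); apply: (additiveD lM.1); last exact: Jx.
  by apply: LM; exists 1; rewrite mul1r.
by apply/seteqP; split=> // y _; rewrite -[y]mulr1; apply: lM.2.
Qed.

(** The left inverse [u] of [1 - x] equals [1 + u x], so it has a left inverse itself, which must be
    [1 - x]. *)
Lemma jacobson_unit (x : T) : jacobson_radical x ->
  exists2 u, u * (1 - x) = 1 & (1 - x) * u = 1.
Proof.
move=> Jx; have [u ux] := jacobson_left_inverse Jx.
have uE : u = 1 - (- u * x).
  by move: ux; rewrite mulrBr mulr1 mulNr opprK => /(canRL (subrK _)).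
have [|v vu] := @jacobson_left_inverse (- u * x).
  by move=> M MM; have [lM _ _] := MM; apply: lM.2; exact: Jx.
rewrite -uE in vu; exists u => //.
by suff -> : 1 - x = v by []; rewrite -[LHS]mul1r -[X in X * _]vu -mulrA ux mulr1.
Qed.

End Jacobson.

(** * Products of bimodules and principal bimodules *)

Section Products.
Variables (A : nzRingType) (R : subringClosed A).
Implicit Types (I J K : set A).

Lemma mul_bimodM I J a b : I a -> J b -> mul_bimod I J (a * b).
Proof.
by move=> Ia Jb; exists 1%N, (fun=> a), (fun=> b); split=> //; rewrite big_ord1.
Qed.

Lemma mul_bimod_sub I J K : additive_subgroup K ->
  (forall a b, I a -> J b -> K (a * b)) -> mul_bimod I J `<=` K.
Proof.
move=> aK IJK _ [n [a [b [Ia Jb ->]]]]; apply: (additive_sum aK) => k.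
exact: IJK.
Qed.

Lemma mul_bimod_bimodule I J : (forall x, I x -> I (- x)) ->
  (forall r x, r \in R -> I x -> I (r * x)) ->
  (forall r x, r \in R -> J x -> J (x * r)) -> bimodule R (mul_bimod I J).
Proof.
move=> IN mI mJ; split; first split.
- by exists 0%N, (fun=> 0), (fun=> 0); split=> [[]//|[]//|]; rewrite big_ord0.
- move=> _ _ [n [a [b [Ia Jb ->]]]] [n' [a' [b' [Ia' Jb' ->]]]].
  exists (n + n')%N, (fun k => match split k with inl i => a i | inr j => - a' j end),
    (fun k => match split k with inl i => b i | inr j => b' j end).
  split=> [k|k|]; try by case: split => // j; exact: IN.
  rewrite big_split_ord -sumrN; congr (_ + _); apply: eq_bigr => k _.
    by rewrite (unsplitK (inl k)).
  by rewrite (unsplitK (inr k)) mulNr.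
- move=> r _ Rr [n [a [b [Ia Jb ->]]]]; split.
    exists n, (fun k => r * a k), b; split=> // [k|]; first exact: mI.
    by rewrite mulr_sumr; apply: eq_bigr => k _; rewrite mulrA.
  exists n, a, (fun k => b k * r); split=> // [k|]; first exact: mJ.
  by rewrite mulr_suml; apply: eq_bigr => k _; rewrite mulrA.
Qed.

Lemma principal_bimodE a :
  principal_bimod R a = mul_bimod [set y | exists2 r, r \in R & y = r * a] [set` R].
Proof.
apply/seteqP; split=> _ [n [r [s [Rr Rs ->]]]].
  by exists n, (fun k => r k * a), s; split=> // k; exists (r k).
have [|t tP] := @choice _ _ (fun k q => q \in R /\ r k = q * a).
  by move=> k; have [q Rq rq] := Rr k; exists q.
exists n, t, s; split=> // [k|]; first by case: (tP k).
by apply: eq_bigr => k _; case: (tP k) => _ ->.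
Qed.

Lemma principal_bimod_bimodule a : bimodule R (principal_bimod R a).
Proof.
rewrite principal_bimodE; apply: mul_bimod_bimodule => [_ [r Rr ->]|r _ Rr [s Rs ->]|].
- by exists (- r); rewrite ?rpredN// mulNr.
- by exists (r * s); rewrite ?rpredM// mulrA.
- by move=> r x Rr Rx; apply: rpredM.
Qed.

Lemma principal_bimod_gen a : principal_bimod R a a.
Proof.
rewrite principal_bimodE -[X in _ X]mulr1; apply: mul_bimodM; last exact: rpred1.
by exists 1; rewrite ?mul1r ?rpred1.
Qed.

Lemma principal_bimod_sub a I : additive_subgroup I ->
  (forall r s, r \in R -> s \in R -> I (r * a * s)) -> principal_bimod R a `<=` I.
Proof.
move=> aI Ia; rewrite principal_bimodE; apply: mul_bimod_sub => // _ s [r Rr ->].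
exact: Ia.
Qed.

End Products.

(** * Residue ring *)

(** Working with a map on all of [A] avoids the subtype of [R]; its values outside [R] are
    unconstrained. That [P] is the Jacobson radical is recorded only as [res_unit]. *)
Record residue_map (A Q : nzRingType) (R : subringClosed A) (P : set A)
    (phi : A -> Q) : Prop := ResidueMap {
  res_simple_artinian : simple_artinian Q;
  resD : forall x y, x \in R -> y \in R -> phi (x + y) = phi x + phi y;
  resM : forall x y, x \in R -> y \in R -> phi (x * y) = phi x * phi y;
  res1 : phi 1 = 1;
  res_surj : forall t, exists2 x, x \in R & phi x = t;
  res_ker : forall x, P x <-> x \in R /\ phi x = 0;
  res_unit : forall x, x \in R -> phi x = 1 ->
    exists u, [/\ u \in R, u * x = 1 & x * u = 1];
  res_dubrovin_l : forall q, q \notin R ->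
    exists r, [/\ r \in R, r * q \in R & phi (r * q) <> 0];
  res_dubrovin_r : forall q, q \notin R ->
    exists r, [/\ r \in R, q * r \in R & phi (q * r) <> 0]
}.

Section Residue.
Variables (A Q : nzRingType) (R : subringClosed A) (P : set A) (phi : A -> Q).
Hypothesis hA : simple_artinian A.
Hypothesis hR : residue_map R P phi.
Let hQ := res_simple_artinian hR.
Let phiD := resD hR.
Let phiM := resM hR.
Let phi1 := res1 hR.

Lemma res0 : phi 0 = 0.
Proof. by apply: (addrI (phi 0)); rewrite -phiD ?rpred0// !addr0. Qed.

Lemma resN x : x \in R -> phi (- x) = - phi x.
Proof.
by move=> Rx; apply: (addrI (phi x)); rewrite -phiD ?rpredN// !subrr res0.
Qed.

Lemma resB x y : x \in R -> y \in R -> phi (x - y) = phi x - phi y.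
Proof. by move=> Rx Ry; rewrite phiD ?rpredN// resN. Qed.

Lemma rad_sub x : P x -> x \in R. Proof. by case/(res_ker hR). Qed.

Lemma radE x : P x -> phi x = 0. Proof. by case/(res_ker hR). Qed.

Lemma radI x : x \in R -> phi x = 0 -> P x.
Proof. by move=> Rx x0; apply/(res_ker hR). Qed.

Lemma radMl r x : r \in R -> P x -> P (r * x).
Proof.
by move=> Rr /(res_ker hR)[Rx x0]; apply: radI; rewrite ?rpredM// phiM// x0 mulr0.
Qed.

Lemma radMr r x : r \in R -> P x -> P (x * r).
Proof.
by move=> Rr /(res_ker hR)[Rx x0]; apply: radI; rewrite ?rpredM// phiM// x0 mul0r.
Qed.

Lemma rad_additive : additive_subgroup P.
Proof.
split; first by apply: radI; rewrite ?rpred0 ?res0.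
move=> x y /(res_ker hR)[Rx x0] /(res_ker hR)[Ry y0].
by apply: radI; rewrite ?rpredB// resB// x0 y0 subr0.
Qed.

Lemma res_neq0 : phi 1 <> 0. Proof. by rewrite phi1; apply/eqP; exact: oner_neq0. Qed.

Lemma res_left_ideal (S : set A) : (forall x, S x -> x \in R) ->
  additive_subgroup S -> (forall r x, r \in R -> S x -> S (r * x)) ->
  left_ideal (phi @` S).
Proof.
move=> SR aS mS; split; first split.
- by exists 0; [case: aS | rewrite res0].
- move=> _ _ [x Sx <-] [y Sy <-]; exists (x - y); first exact: (additiveB aS).
  by rewrite resB//; apply: SR.
- move=> t _ [x Sx <-]; have [r Rr <-] := res_surj hR t.
  by exists (r * x); [exact: mS | rewrite phiM//; apply: SR].
Qed.

Lemma res_right_ideal (S : set A) : (forall x, S x -> x \in R) ->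
  additive_subgroup S -> (forall r x, r \in R -> S x -> S (x * r)) ->
  right_ideal (phi @` S).
Proof.
move=> SR aS mS; split; first split.
- by exists 0; [case: aS | rewrite res0].
- move=> _ _ [x Sx <-] [y Sy <-]; exists (x - y); first exact: (additiveB aS).
  by rewrite resB//; apply: SR.
- move=> t _ [x Sx <-]; have [r Rr <-] := res_surj hR t.
  by exists (x * r); [exact: mS | rewrite phiM//; apply: SR].
Qed.

(* Simplicity of the residue ring, in the form in which it is used: an        *)
(* R-subbimodule of R that is not contained in P contains a unit of R.        *)
Lemma res_bimodule_unit (S : set A) : (forall x, S x -> x \in R) ->
  bimodule R S -> (exists2 x, S x & phi x <> 0) ->
  exists s u, [/\ S s, phi s = 1, u \in R, u * s = 1 & s * u = 1].
Proof.
move=> SR [aS mS] [x Sx x0].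
have tI : two_sided_ideal (phi @` S).
  by split; [apply: res_left_ideal | apply: res_right_ideal] => //
    r y Rr Sy; have [] := mS r y Rr Sy.
have [|s Ss s1] := two_sided_ideal_full hQ.1 tI.
  by exists (phi x) => //; exists x.
by have [u [Ru us su]] := res_unit hR (SR _ Ss) s1; exists s, u.
Qed.

Lemma res_invertible c : c \in R -> (forall x, x \in R -> phi (c * x) = 0 -> phi x = 0) ->
  exists2 d, d \in R & c * d = 1.
Proof.
move=> Rc inj; have [|t _ ct] := @lreg_invertible Q hQ (phi c).
  move=> t; have [x Rx <-] := res_surj hR t.
  by rewrite -phiM// => /inj; apply.
have [d Rd dt] := res_surj hR t; rewrite -dt -phiM// in ct.
have [u [Ru _ cdu]] := res_unit hR (rpredM Rc Rd) ct.
by exists (d * u); rewrite ?rpredM// mulrA.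
Qed.

(** Otherwise [A a] lies in [P]. For [b] with [a b a = a], the element [1 - b a] is then a unit with
    [a (1 - b a) = 0]. *)
Lemma normalize_l a : a <> 0 -> exists q, q * a \in R /\ phi (q * a) <> 0.
Proof.
move=> a0; apply: contrapT => noq.
have Pqa q : P (q * a).
  have [Rqa|nRqa] := boolP (q * a \in R).
    by apply: radI => //; apply: contrapT => qa0; apply: noq; exists q.
  have [r [Rr Rrqa rqa0]] := res_dubrovin_l hR nRqa.
  by exfalso; apply: noq; exists (r * q); rewrite -mulrA.
have [b aba] := von_neumann_regular hA a.
have [u [_ _ u1]] : exists u, [/\ u \in R, u * (1 - b * a) = 1 & (1 - b * a) * u = 1].
  have Rba := rad_sub (Pqa b).
  by apply: (res_unit hR); rewrite ?rpredB ?rpred1// resB ?rpred1// (radE (Pqa b)) subr0.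
by apply: a0; rewrite -[a]mulr1 -u1 mulrA mulrBr mulr1 mulrA aba subrr mul0r.
Qed.

Lemma normalize_r a : a <> 0 -> exists q, a * q \in R /\ phi (a * q) <> 0.
Proof.
move=> a0; apply: contrapT => noq.
have Paq q : P (a * q).
  have [Raq|nRaq] := boolP (a * q \in R).
    by apply: radI => //; apply: contrapT => aq0; apply: noq; exists q.
  have [r [Rr Raqr aqr0]] := res_dubrovin_r hR nRaq.
  by exfalso; apply: noq; exists (q * r); rewrite mulrA.
have [b aba] := von_neumann_regular hA a.
have [u [_ u1 _]] : exists u, [/\ u \in R, u * (1 - a * b) = 1 & (1 - a * b) * u = 1].
  have Rab := rad_sub (Paq b).
  by apply: (res_unit hR); rewrite ?rpredB ?rpred1// resB ?rpred1// (radE (Paq b)) subr0.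
by apply: a0; rewrite -[a]mul1r -u1 -mulrA mulrBl mul1r aba subrr mulr0.
Qed.

Lemma normalize_pair a b : ~ (a = 0 /\ b = 0) -> exists q,
  [/\ q * a \in R, q * b \in R & ~ (phi (q * a) = 0 /\ phi (q * b) = 0)].
Proof.
move=> ab0; have [a0|a0] := pselect (a = 0).
  have [|q [Rqb qb0]] := @normalize_l b; first by move=> b0; apply: ab0.
  by exists q; rewrite a0 mulr0 rpred0; split=> // -[_].
have [q [Rqa qa0]] := normalize_l a0.
have [Rqb|/(res_dubrovin_l hR)[r [Rr Rrqb rqb0]]] := boolP (q * b \in R).
  by exists q; split=> // -[].
by exists (r * q); rewrite -!mulrA; split=> //; [exact: rpredM | case].
Qed.

(** The [r] in [R] with [q r] in [R] have residues [k Q] with [k] idempotent; let [e] lift [1 - k].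
    If [q] is not in [R], neither is [q e], and some [q e s] in [R] has nonzero residue. But the
    residue of [e s] lies in both [k Q] and [(1 - k) Q], so [e s] is in [P], and [q e s] with it. *)
Lemma order_closed q : (forall p, P p -> P (q * p)) -> q \in R.
Proof.
move=> qP; apply: contrapT => /negP nRq.
pose S := [set r | r \in R /\ q * r \in R].
have rS : right_ideal (phi @` S).
  apply: res_right_ideal; first by move=> x [].
  - split; first by rewrite /S /= mulr0 rpred0.
    by move=> x y [Rx Rqx] [Ry Rqy]; split; rewrite ?mulrBr rpredB.
  - by move=> r x Rr [Rx Rqx]; split; rewrite ?mulrA rpredM.
have [k [r [Rr Rqr] rk] kP] := right_ideal_idempotent hQ rS.
have [e Re eE] := res_surj hR (1 - k).
have eS t : S t -> phi (e * t) = 0.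
  move=> [Rt Rqt]; rewrite phiM// eE mulrBl mul1r kP ?subrr//.
  by exists t.
have nRqe : q * e \notin R.
  apply/negP => Rqe; have ee0 := eS e (conj Re Rqe).
  have kk : k * k = k by apply: kP; exists r.
  move: ee0; rewrite phiM// eE mulrBl mul1r mulrBr mulr1 kk subrr subr0 => k1.
  have r1 : phi r = 1 by rewrite rk; apply/esym/subr0_eq.
  have [u [Ru _ ru]] := res_unit hR Rr r1.
  by move: nRq; rewrite -[q]mulr1 -ru mulrA rpredM.
have [s [Rs Rqes qes0]] := res_dubrovin_r hR nRqe.
apply: qes0; rewrite -mulrA; apply: radE; apply: qP; apply: radI; first exact: rpredM.
have Ses : S (e * s) by split; [exact: rpredM | rewrite mulrA].
have kes : k * phi (e * s) = phi (e * s).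
  by apply: kP; exists (e * s).
rewrite -kes phiM// eE mulrA mulrBr mulr1.
have -> : k * k = k by apply: kP; exists r.
by rewrite subrr mul0r.
Qed.

(** * Two-generated modules *)

Definition rspan (y z : A) : set A :=
  [set w | exists a b, [/\ a \in R, b \in R & w = y * a + z * b]].

Lemma rspan_addl y z t : t \in R -> rspan (y + z * t) z = rspan y z.
Proof.
move=> Rt; apply/seteqP; split=> _ [a [b [Ra Rb ->]]].
  exists a, (t * a + b); split; rewrite ?rpredD ?rpredM//.
  by rewrite mulrDl mulrDr -addrA mulrA.
exists a, (b - t * a); split; rewrite ?rpredB ?rpredM//.
by rewrite mulrDl mulrBr -addrA mulrA [z * b - _]addrC addNKr.
Qed.

Lemma rspanC y z : rspan y z = rspan z y.
Proof.
by apply/seteqP; split=> _ [a [b [Ra Rb ->]]]; exists b, a; rewrite addrC.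
Qed.

Lemma rspan_addr y z t : t \in R -> rspan y (z + y * t) = rspan y z.
Proof. by move=> Rt; rewrite rspanC rspan_addl// rspanC. Qed.

(* For the module I generated by y and z, { q | q y, q z in R } consists of   *)
(* the q with q I in R, so it does not depend on the choice of generators.    *)
Definition first_residues (y z : A) : set Q :=
  phi @` [set w | exists q, [/\ q * y \in R, q * z \in R & w = q * y]].

(** The pairs [(phi (q * y), phi (q * z))] with both products in [R] form a left submodule of [Q^2].
    [first_residues] is its first projection, and this is its intersection with the second axis. *)
Definition second_residues (y z : A) : set Q :=
  phi @` [set w | exists q,
    [/\ q * y \in R, q * z \in R, phi (q * y) = 0 & w = q * z]].

Lemma first_residues_ideal y z : left_ideal (first_residues y z).
Proof.
apply: res_left_ideal; first by move=> _ [q [Ry _ ->]].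
- split; first by exists 0; rewrite !mul0r rpred0.
  move=> _ _ [q [qy qz ->]] [q' [qy' qz' ->]].
  by exists (q - q'); split; rewrite ?mulrBl ?rpredB.
- move=> r _ Rr [q [qy qz ->]].
  by exists (r * q); rewrite -!mulrA; split=> //; exact: rpredM.
Qed.

Lemma second_residues_ideal y z : left_ideal (second_residues y z).
Proof.
apply: res_left_ideal; first by move=> _ [q [_ Rz _ ->]].
- split; first by exists 0; rewrite !mul0r rpred0 res0.
  move=> _ _ [q [qy qz qy0 ->]] [q' [qy' qz' qy'0 ->]].
  by exists (q - q'); split; rewrite ?mulrBl ?rpredB ?resB ?qy0 ?qy'0 ?subr0.
- move=> r _ Rr [q [qy qz qy0 ->]].
  exists (r * q); rewrite -!mulrA; split=> //; try exact: rpredM.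
  by rewrite phiM// qy0 mulr0.
Qed.

(** Multiplication by [phi h] kills [second_residues], so it turns the residue of [q z1] into a
    linear function [x w] of the residue [x] of [q y]. Hence a multiple of [z1] can be subtracted
    from [y] to cancel part of [x]. *)
Lemma first_residues_shrink y z : (exists2 x, first_residues y z x & x <> 0) ->
  ~ second_residues y z 1 ->
  exists y' z', [/\ rspan y' z' = rspan y z,
    first_residues y' z' `<=` first_residues y z &
    first_residues y' z' <> first_residues y z].
Proof.
move=> [l Fl l0] K1; have lF := first_residues_ideal y z.
have [e Fe eP] := left_ideal_idempotent hQ lF.
have [k Kk kP] := left_ideal_idempotent hQ (second_residues_ideal y z).
have e0 : e <> 0 by move=> e0; apply: l0; rewrite -(eP l Fl) e0 mulr0.
have [h Rh hE] := res_surj hR (1 - k).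
have h0 : phi h <> 0.
  by rewrite hE => /subr0_eq k1; apply: K1; rewrite k1.
have Kh x : second_residues y z x -> x * phi h = 0.
  by move=> Kx; rewrite hE mulrBr mulr1 kP// subrr.
have [_ [q0 [q0y q0z ->]] q0e] := Fe.
(* [z1] is [z] unless [phi h] kills every residue of [q z]. In that case it is [z + y s], where
   primeness provides [s] with [e * phi s * phi h] nonzero. *)
have [z1 [span1 z1R R1z Kz1 [q1 [q1y q1z q1h]]]] : exists z1,
    [/\ rspan y z1 = rspan y z,
     forall q, q * y \in R -> q * z \in R -> q * z1 \in R,
     forall q, q * y \in R -> q * z1 \in R -> q * z \in R,
     forall q, q * y \in R -> q * z1 \in R -> phi (q * y) = 0 ->
       phi (q * z1) * phi h = 0 &
     exists q, [/\ q * y \in R, q * z1 \in R & phi (q * z1) * phi h <> 0]].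
  have [[q [qy qz qh]]|noq] := pselect (exists q,
      [/\ q * y \in R, q * z \in R & phi (q * z) * phi h <> 0]).
    exists z; split=> //; last by exists q.
    by move=> p py pz py0; apply: Kh; exists (p * z) => //; exists p.
  have [t esh] := simple_prime hQ e0 h0; have [s Rs sE] := res_surj hR t.
  have z1E q : q * (z + y * s) = q * z + q * y * s by rewrite mulrDr mulrA.
  have Rys q : q * y \in R -> q * y * s \in R by move=> qy; exact: rpredM.
  have bw q : q * y \in R -> q * (z + y * s) \in R -> q * z \in R.
    by move=> qy; rewrite z1E rpredDr// Rys.
  exists (z + y * s); split => //; first exact: rspan_addr.
  - by move=> q qy qz; rewrite z1E rpredD// Rys.
  - move=> q qy qz1 qy0; have qz := bw q qy qz1.
    rewrite z1E phiD ?Rys// (phiM qy Rs) qy0 mul0r addr0.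
    by apply: Kh; exists (q * z) => //; exists q.
  - exists q0; split=> //; first by rewrite z1E rpredD// Rys.
    rewrite z1E phiD ?Rys// (phiM q0y Rs) q0e sE mulrDl => E; apply: esh.
    have zh0 : phi (q0 * z) * phi h = 0.
      by apply: contrapT => ne; apply: noq; exists q0.
    by rewrite zh0 add0r in E.
have q0z1 := z1R _ q0y q0z.
pose w := phi (q0 * z1) * phi h.
have wE q : q * y \in R -> q * z1 \in R -> phi (q * z1) * phi h = phi (q * y) * w.
  move=> qy qz1; have qz := R1z q qy qz1.
  have Fqy : first_residues y z (phi (q * y)) by exists (q * y) => //; exists q.
  (* The first residue of this combination is [phi (q * y) * (1 - e) = 0], so [phi h] kills the
     second one. *)
  have := Kz1 (q - (q * y) * q0).
  have Ry : q * y * q0 * y \in R by rewrite -mulrA rpredM.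
  have Rz : q * y * q0 * z1 \in R by rewrite -mulrA rpredM.
  rewrite !mulrBl !rpredB// !resB// => /(_ isT isT).
  rewrite -!(mulrA (q * y)) (phiM qy q0y) (phiM qy q0z1) q0e eP// subrr => /(_ erefl).
  by rewrite mulrBl -mulrA => /subr0_eq.
have ew : w = e * w by rewrite -q0e; exact: wE.
have w0 : w <> 0 by move=> w0; apply: q1h; rewrite wE// w0 mulr0.
have [cc wcw] := von_neumann_regular hQ w.
have [c Rc cE] := res_surj hR cc; have [ee Ree eeE] := res_surj hR e.
pose g := w * cc; have eg : e * g = g by rewrite /g mulrA -ew.
have gg : g * g = g by rewrite /g mulrA wcw.
have Rt : - (h * c * ee) \in R by rewrite rpredN !rpredM.
(* Subtracting this multiple of z1 from y multiplies the residues of q y by   *)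
(* 1 - g e on the right, which kills the nonzero idempotent g e of Q e.       *)
pose y' := y + z1 * - (h * c * ee).
have y'E q : q * y' = q * y - q * z1 * (h * c * ee).
  by rewrite /y' mulrDr !mulrN mulrA.
have Rzt q : q * z1 \in R -> q * z1 * (h * c * ee) \in R.
  by move=> qz1; apply: rpredM => //; rewrite !rpredM.
have phiy' q : q * y \in R -> q * z1 \in R ->
    phi (q * y') = phi (q * y) * (1 - g * e).
  move=> qy qz1; rewrite y'E resB ?Rzt// (phiM qz1) ?rpredM//.
  rewrite phiM ?rpredM// phiM// !mulrA wE// cE eeE.
  by rewrite mulrBr mulr1 /g !mulrA.
have bw q : q * y' \in R -> q * z1 \in R -> q * y \in R.
  by move=> + qz1; rewrite y'E rpredBr// Rzt.
exists y', z1; split.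
- by rewrite rspan_addl.
- move=> _ [_ [q [qy' qz1 ->]] <-]; have qy := bw q qy' qz1.
  have qz := R1z q qy qz1; rewrite phiy'// mulrBr mulr1.
  have Fqy : first_residues y z (phi (q * y)) by exists (q * y) => //; exists q.
  by apply: (additiveB lF.1) => //; rewrite mulrA; apply: lF.2.
- move=> EF; move: Fe; rewrite -EF => -[_ [q [qy' qz1 ->]]].
  have qy := bw q qy' qz1; rewrite phiy'// => eE.
  have gege : g * e * (g * e) = g * e by rewrite -mulrA (mulrA e) eg mulrA gg.
  have : e * (g * e) = 0 by rewrite -{1}eE -mulrA mulrBl mul1r gege subrr mulr0.
  rewrite mulrA eg => ge0; apply: w0.
  have g0 : g = 0 by rewrite -gg -{2}eg mulrA ge0 mul0r.
  by rewrite -wcw -/g g0 mul0r.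
Qed.

(* The generators (y, z) of R + x R are changed until first_residues y z is   *)
(* minimal; then z generates alone and is a unit of A.                        *)
Lemma bezout x : exists c z, [/\ c * z = 1, z * c = 1, c \in R, c * x \in R &
  exists a b, [/\ a \in R, b \in R & z = a + x * b]].
Proof.
pose S X := exists y z, rspan y z = rspan 1 x /\ X = first_residues y z.
have [|X [_ [y [z [Eyz EX]]] minX]] := @dcc_minimal Q (@left_ideal Q) S hQ.2.1.
  exists (first_residues 1 x); first exact: first_residues_ideal.
  by exists 1, x.
have [a1 [b1 [Ra1 Rb1 yz1]]] : rspan y z 1.
  by rewrite Eyz; exists 1, 0; rewrite rpred1 rpred0 mulr1 mulr0 addr0.
have [ax [bx [Rax Rbx yzx]]] : rspan y z x.
  by rewrite Eyz; exists 0, 1; rewrite rpred1 rpred0 mulr1 mulr0 add0r.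
have [a [b [Ra Rb zE]]] : rspan 1 x z.
  by rewrite -Eyz; exists 0, 1; rewrite rpred1 rpred0 mulr1 mulr0 add0r.
rewrite mul1r in zE.
suff [c cz cy] : exists2 c, c * z = 1 & c * y \in R.
  exists c, z; split; rewrite ?(left_inverse_invertible hA cz)//; last by exists a, b.
    by rewrite -[c]mulr1 yz1 mulrDr !mulrA cz mul1r rpredD// rpredM.
  by rewrite yzx mulrDr !mulrA cz mul1r rpredD// rpredM.
(* In the first case [q z] is a unit of [R], and dividing by it turns [q] into the inverse of
   [z]. *)
have [[_ [q [qy qz qy0 ->]] qz1]|K1] := pselect (second_residues y z 1).
  have [u [Ru uqz _]] := res_unit hR qz qz1.
  by exists (u * q); rewrite -!mulrA// rpredM.
have F0 l : first_residues y z l -> l = 0.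
  move=> Fl; apply: contrapT => l0.
  have [|y' [z' [E sub ne]]] := @first_residues_shrink y z _ K1; first by exists l.
  apply: ne; rewrite -EX; apply: minX; first exact: first_residues_ideal.
    by exists y', z'; rewrite E.
  by rewrite EX.
(* A nonzero [q] with [q z = 0] has [q y] nonzero; normalizing the pair would give a nonzero first
   residue. *)
have inj q : q * z = 0 -> q = 0.
  move=> qz0; apply: contrapT => q0.
  have [|p []] := @normalize_pair (q * y) (q * z).
    move=> [qy0 _]; apply: q0.
    by rewrite -[q]mulr1 yz1 mulrDr !mulrA qy0 qz0 !mul0r addr0.
  rewrite !mulrA => py pz; case; split; last by rewrite -mulrA qz0 mulr0 res0.
  by apply: F0; exists (p * q * y) => //; exists (p * q).
have [c cz zc] := rreg_invertible hA inj.
exists c => //; apply: contrapT => /negP /(res_dubrovin_l hR)[r [Rr Rrcy]]; apply.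
rewrite mulrA in Rrcy *; apply: F0; exists (r * c * y) => //; exists (r * c).
by split=> //; rewrite -mulrA cz mulr1.
Qed.

(** [bezout] supplies a left denominator of the fraction [s g]. *)
Lemma ore c g s : c \in R -> c * g = 1 -> g * c = 1 -> s \in R ->
  exists c' g' s', [/\ c' \in R, c' * g' = 1, g' * c' = 1, s' \in R & c' * s = s' * c].
Proof.
move=> Rc cg gc Rs; have [c' [g' [cg' gc' Rc' Rs' _]]] := bezout (s * g).
by exists c', g', (c' * (s * g)); rewrite -!mulrA gc mulr1.
Qed.

(** * The square of the radical *)

Local Notation P2 := (mul_bimod P P).

Lemma rad_bimodule : bimodule R P.
Proof.
by split=> [|r x Rr Px]; [exact: rad_additive | split; [exact: radMl | exact: radMr]].
Qed.

Lemma rad2_bimodule : bimodule R P2.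
Proof.
apply: mul_bimod_bimodule; [|exact: radMl|exact: radMr].
by move=> x; exact: additiveN rad_additive.
Qed.

Lemma rad2_additive : additive_subgroup P2.
Proof. by have [] := rad2_bimodule. Qed.

Lemma rad2Ml r x : r \in R -> P2 x -> P2 (r * x).
Proof. by move=> Rr /(rad2_bimodule.2 _ _ Rr)[]. Qed.

Lemma rad2Mr r x : r \in R -> P2 x -> P2 (x * r).
Proof. by move=> Rr /(rad2_bimodule.2 _ _ Rr)[]. Qed.

(* P / P2 is a nonzero bimodule over the simple ring R / P, hence faithful on *)
(* both sides.                                                                *)
Lemma rad2_corner e : e \in R -> phi e <> 0 -> ~ P `<=` P2 ->
  exists2 y, P y & ~ P2 (e * y * e).
Proof.
move=> Re e0 nPP2; apply: contrapT => noy; apply: nPP2.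
have eye y : P y -> P2 (e * y * e).
  by move=> Py; apply: contrapT => ne; apply: noy; exists y.
pose S := [set t | t \in R /\ forall y, P y -> P2 (e * y * t)].
have bS : bimodule R S.
  split; first split.
  - split; first exact: rpred0.
    by move=> y _; rewrite mulr0; apply: additive0 rad2_additive.
  - move=> s t [Rs Hs] [Rt Ht]; split; first exact: rpredB.
    move=> y Py; rewrite mulrBr; apply: (additiveB rad2_additive); first exact: Hs.
    exact: Ht.
  - move=> r t Rr [Rt Ht]; split; split; try exact: rpredM.
      by move=> y Py; rewrite mulrA -(mulrA e); apply: Ht; exact: radMr.
    by move=> y Py; rewrite mulrA; apply: rad2Mr => //; exact: Ht.
have [||s [u [[Rs Hs] _ Ru us su]]] := @res_bimodule_unit S _ bS.
- by move=> t [].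
- by exists e.
have ey y : P y -> P2 (e * y).
  by move=> Py; rewrite -[_ * y]mulr1 -su mulrA; apply: rad2Mr => //; exact: Hs.
pose S' := [set t | t \in R /\ forall y, P y -> P2 (t * y)].
have bS' : bimodule R S'.
  split; first split.
  - split; first exact: rpred0.
    by move=> y _; rewrite mul0r; apply: additive0 rad2_additive.
  - move=> t t' [Rt Ht] [Rt' Ht']; split; first exact: rpredB.
    move=> y Py; rewrite mulrBl; apply: (additiveB rad2_additive); first exact: Ht.
    exact: Ht'.
  - move=> r t Rr [Rt Ht]; split; split; try exact: rpredM.
      by move=> y Py; rewrite -mulrA; apply: rad2Ml => //; exact: Ht.
    by move=> y Py; rewrite -mulrA; apply: Ht; exact: radMl.
have [||s' [u' [[Rs' Hs'] _ Ru' us' _]]] := @res_bimodule_unit S' _ bS'.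
- by move=> t [].
- by exists e.
move=> y Py; rewrite -[y]mul1r -us' -mulrA; apply: rad2Ml => //; exact: Hs'.
Qed.

(* An element of P / P2 with zero right annihilator is obtained by adding     *)
(* elements of the corners e (P / P2) e, for orthogonal minimal idempotents e *)
(* of R / P.                                                                  *)
Lemma rad2_regular : ~ P `<=` P2 ->
  exists2 b, P b & forall t, t \in R -> P2 (b * t) -> phi t = 0.
Proof.
move=> nPP2; have a2 := rad2_additive; have aP := rad_additive.
(* [m] is a partial solution on the corner of the idempotent [phi g]. Minimizing the annihilator of
   [phi g] enlarges this corner until [phi g = 1]. *)
pose S (X : set Q) := exists g m, [/\ g \in R, P m & [/\ phi g * phi g = phi g,
  P2 (g * m - m), forall t, t \in R -> P2 (m * t) -> phi g * phi t = 0 &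
  X = [set t | phi g * t = 0]]].
have annI (c : Q) : right_ideal [set t | c * t = 0].
  split; first split; first exact: mulr0.
    by move=> s t /= s0 t0; rewrite mulrBr s0 t0 subr0.
  by move=> r t /= t0; rewrite mulrA t0 mul0r.
have [|X [_ [g [m [Rg Pm [gg gm gt XE]]]] minX]] :=
    @dcc_minimal Q (@right_ideal Q) S hQ.2.2.
  exists [set t | phi 0 * t = 0]; first exact: annI.
  exists 0, 0; rewrite rpred0; split=> //; first exact: additive0.
  rewrite res0 !mul0r subr0; split=> //; first exact: additive0 a2.
  by move=> t _ _; rewrite mul0r.
have [g1|g1] := pselect (phi g = 1).
  by exists m => // t Rt mt; rewrite -[phi t]mul1r -g1; exact: gt.
have nX : exists2 x, X x & x <> 0.
  exists (1 - phi g); first by rewrite XE /= mulrBr mulr1 gg subrr.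
  by move=> /subr0_eq /esym.
have [Y [rY [y0 Yy0 y00] YX minY]] : exists M, [/\ right_ideal M,
    (exists2 x, M x & x <> 0), M `<=` X & forall Y, right_ideal Y ->
    Y `<=` M -> (exists2 x, Y x & x <> 0) -> Y = M].
  by apply: minimal_right_ideal => //; rewrite XE; exact: annI.
have [f Yf fP] := right_ideal_idempotent hQ rY.
have gf : phi g * f = 0 by move: (YX _ Yf); rewrite XE.
have ff : f * f = f by exact: fP.
(* Only [phi g * f = 0] is known; the factor [1 - phi g] makes the idempotent orthogonal to [phi g]
   on both sides. *)
pose e' := f * (1 - phi g).
have e'f : e' * f = f by rewrite /e' -mulrA mulrBl mul1r gf subr0.
have e'e' : e' * e' = e' by rewrite {2}/e' mulrA e'f.
have e'0 : e' <> 0.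
  by move=> e0; apply: y00; rewrite -(fP _ Yy0) -e'f e0 !mul0r.
have e'g : e' * phi g = 0 by rewrite /e' -mulrA mulrBl mul1r gg subrr mulr0.
have ge' : phi g * e' = 0 by rewrite /e' mulrA gf mul0r.
have [e Re eE] := res_surj hR e'.
have [|y Py y2] := @rad2_corner e Re _ nPP2; first by rewrite eE.
have Pge : P (g * e) by apply: radI; rewrite ?rpredM// phiM// eE ge'.
have Peg : P (e * g) by apply: radI; rewrite ?rpredM// phiM// eE e'g.
have Pee : P (e * e - e).
  by apply: radI; rewrite ?rpredB ?rpredM// resB ?rpredM// phiM// eE e'e' subrr.
pose m' := e * y * e.
have Pm' : P m' by apply: radMr => //; exact: radMl.
have Rge : g + e \in R by rewrite rpredD.
have geE : phi (g + e) = phi g + e' by rewrite phiD// eE.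
(* Left multiplication by [g] separates the summands modulo [P2]: it fixes [m], and it kills [m']
   because [g e] is in [P]. *)
have kill t : t \in R -> P2 ((m + m') * t) -> phi (g + e) * phi t = 0.
  move=> Rt mt.
  have mt2 : P2 (m * t).
    have -> : m * t = g * ((m + m') * t) - (g * m - m) * t - (g * e) * (y * e * t).
      rewrite mulrBl mulrDl mulrDr /m' !mulrA.
      by rewrite opprB addrAC addrK addrC subrK.
    apply: (additiveB a2); last first.
      by apply: mul_bimodM => //; apply: radMr => //; exact: radMr.
    by apply: (additiveB a2); [exact: rad2Ml | exact: rad2Mr].
  have m't2 : P2 (m' * t).
    have -> : m' * t = (m + m') * t - m * t by rewrite mulrDl addrC addKr.
    exact: (additiveB a2).
  rewrite geE mulrDl (gt t Rt mt2) add0r -eE -phiM//.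
  apply: contrapT => et0.
  (* This right ideal contains the nonzero [phi (e * t)], so by minimality it is [Y]. As it then
     contains [e'], [m'] itself would lie in [P2]. *)
  have : (phi @` [set s | [/\ s \in R, Y (phi s) & P2 (m' * s)]]) e'.
    rewrite [X in X e'](_ : _ = Y); first by apply: rY.2.
    apply: minY; last first.
    - exists (phi (e * t)) => //; exists (e * t) => //; split; first exact: rpredM.
        by rewrite phiM// eE /e' -mulrA; apply: rY.2.
      have -> : m' * (e * t) = m' * t + e * y * ((e * e - e) * t).
        by rewrite /m' mulrBl mulrBr !mulrA addrC subrK.
      apply: (additiveD a2) => //; apply: mul_bimodM; first exact: radMl.
      exact: radMr.
    - by move=> _ [s [_ Ys _] <-].
    - apply: res_right_ideal; first by move=> s [].
      + split; first split; rewrite ?rpred0 ?res0 ?mulr0//.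
        * by case: rY.1.
        * exact: additive0 a2.
        * move=> s s' [Rs Ys ms] [Rs' Ys' ms']; split; first exact: rpredB.
            by rewrite resB//; exact: (additiveB rY.1).
          by rewrite mulrBr; exact: (additiveB a2).
      + move=> r s Rr [Rs Ys ms]; split; first exact: rpredM.
          by rewrite phiM//; exact: rY.2.
        by rewrite mulrA; exact: rad2Mr.
  case=> s [Rs _ ms] sE; apply: y2.
  have -> : e * y * e = m' * s - m' * (s - e) - e * y * (e * e - e).
    rewrite !mulrBr !mulrA opprB [m' * s + _]addrC subrK.
    by rewrite opprB addrC subrK.
  apply: (additiveB a2); last by apply: mul_bimodM => //; exact: radMl.
  apply: (additiveB a2) => //; apply: mul_bimodM => //.
  by apply: radI; rewrite ?rpredB// resB// eE sE subrr.
(* This contradicts the fact that [e'] is killed by [phi g] but not by [phi (g + e)]. *)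
have E : [set t | phi (g + e) * t = 0] = X.
  apply: minX; first exact: annI.
    exists (g + e), (m + m'); split=> //; first exact: (additiveD aP).
    split=> //.
      by rewrite geE mulrDl !mulrDr gg ge' e'g e'e' addr0 add0r.
    have -> : (g + e) * (m + m') - (m + m') = (g * m - m) + g * e * (y * e) +
        ((e * g) * m - e * (g * m - m)) + (e * e - e) * (y * e).
      rewrite /m' !mulrDl !mulrDr !(mulNr, mulrN) !mulrA.
      rewrite opprB [e * g * m + _]addrC subrK addrA opprD.
      by rewrite [_ - m + _]addrAC [_ - m + _]addrAC addrACA.
    apply: (additiveD a2); last by apply: mul_bimodM => //; exact: radMr.
    apply: (additiveD a2).
      by apply: (additiveD a2) => //; apply: mul_bimodM => //; exact: radMr.
    by apply: (additiveB a2); [exact: mul_bimodM | exact: rad2Ml].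
  move=> t /= ht; rewrite XE /=.
  suff -> : phi g = phi g * phi (g + e) by rewrite -mulrA ht mulr0.
  by rewrite geE mulrDr gg ge' addr0.
have : X e' by rewrite XE /= ge'.
by rewrite -E /= geE mulrDl ge' add0r e'e'.
Qed.

(** * Normalizing units *)

(** With [P = 0] a denominator [c] of [a] is cancellable modulo [P], hence invertible in [R]. *)
Lemma rad_trivial_full : (forall x, P x -> x = 0) -> forall a, a \in R.
Proof.
move=> P0 a; have [c [z [cz zc Rc Rca _]]] := bezout a.
have [|d Rd cd] := @res_invertible c Rc.
  move=> x Rx cx0; have cx : c * x = 0 by apply: P0; apply: radI; rewrite ?rpredM.
  by rewrite -[x]mul1r -zc -mulrA cx mulr0 res0.
suff <- : d * (c * a) = a by rewrite rpredM.
by rewrite (_ : d = z) ?mulrA ?zc ?mul1r// -[d]mul1r -zc -mulrA cd mulr1.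
Qed.

(** Equivalently, [w] is a unit of [A] with inverse [w'], and [w R = R w]. *)
Definition normalizing (w w' : A) : Prop :=
  [/\ w * w' = 1, w' * w = 1, forall r, r \in R -> w * r * w' \in R &
      forall r, r \in R -> w' * r * w \in R].

Lemma normalizing1 : normalizing 1 1.
Proof. by split=> [||r|r]; rewrite ?mulr1 ?mul1r. Qed.

Lemma normalizingV w w' : normalizing w w' -> normalizing w' w.
Proof. by case. Qed.

Lemma normalizingM u u' w w' : normalizing u u' -> normalizing w w' ->
  normalizing (u * w) (w' * u').
Proof.
move=> [uu' u'u Ru Ru'] [ww' w'w Rw Rw']; split=> [||r Rr|r Rr].
- by rewrite mulrA -(mulrA u) ww' mulr1.
- by rewrite mulrA -(mulrA w') u'u mulr1.
- by rewrite mulrA -(mulrA u) -(mulrA u); apply: Ru; exact: Rw.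
- by rewrite mulrA -!(mulrA w') mulrA; apply: Rw'; exact: Ru'.
Qed.

Lemma normalizingX w w' n : normalizing w w' -> normalizing (w ^+ n) (w' ^+ n).
Proof.
move=> Nw; elim: n => [|n IHn]; first exact: normalizing1.
by rewrite exprSr exprS; exact: normalizingM.
Qed.

Lemma normalizing_mull w w' r x : normalizing w w' -> r \in R -> w * x \in R ->
  w * (r * x) \in R.
Proof.
move=> [_ w'w Rw _] Rr Rwx.
have -> : w * (r * x) = w * r * w' * (w * x) by rewrite -!mulrA (mulrA w') w'w mul1r.
by rewrite rpredM ?Rw.
Qed.

(** [w] is the inverse of the generator [b], so from here on [w ^+ n * a \in R] says that [a] lies
    in [b^n R]. *)
Lemma rad_generator : ~ P `<=` P2 ->
  exists w w', normalizing w w' /\ forall a, P a <-> w * a \in R.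
Proof.
move=> /rad2_regular[b Pb bP]; have Rb := rad_sub Pb.
have [|w wb bw] := @lreg_invertible A hA b.
  move=> t bt; apply: contrapT => t0; have [s [Rts]] := normalize_r t0; apply.
  by apply: bP => //; rewrite mulrA bt mul0r; apply: additive0 rad2_additive.
have PE a : P a <-> w * a \in R.
  split=> [Pa|Rwa]; last by rewrite -[a]mul1r -bw -mulrA; exact: radMr.
  have [c [z [cz zc Rc Rcwa [x [y [Rx Ry zE]]]]]] := bezout (w * a).
  have Pbz : P (b * z).
    rewrite zE mulrDr !mulrA bw mul1r.
    by apply: (additiveD rad_additive); exact: radMr.
  have [|d Rd cd] := @res_invertible c Rc.
    (* Both factors lie in [P], so the choice of [b] forces [t] into [P]: the denominator [c] of
       [w a] is invertible in [R]. *)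
    move=> t Rt ct0; apply: bP => //; have -> : b * t = b * z * (c * t).
      by rewrite mulrA -(mulrA b) zc mulr1.
    by apply: mul_bimodM => //; apply: radI; rewrite ?rpredM.
  suff <- : d * (c * (w * a)) = w * a by rewrite rpredM.
  by rewrite (_ : d = z) 1?mulrA ?zc ?mul1r// -[d]mul1r -zc -mulrA cd mulr1.
exists w, b; split=> //; split=> // r Rr.
  by rewrite -mulrA; apply/PE; exact: radMl.
apply: order_closed => p /PE Rwp.
have -> : b * r * w * p = b * (r * (w * p)) by rewrite !mulrA.
by apply: radMr => //; exact: rpredM.
Qed.

(** * Denominators and bimodules when the radical is principal *)

Section Principal.
Variables w w' : A.
Hypothesis Nw : normalizing w w'.
Hypothesis PE : forall a, P a <-> w * a \in R.
Hypothesis sepP : forall a, a <> 0 -> exists n, w ^+ n * a \notin R.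

Let w'w : w' * w = 1. Proof. by case: Nw. Qed.
Let ww' : w * w' = 1. Proof. by case: Nw. Qed.

Lemma generator_mem n : w' ^+ n \in R.
Proof. by rewrite rpredX//; apply: rad_sub; apply/PE; rewrite ww' rpred1. Qed.

Lemma generator_antitone m n x : (m <= n)%N -> w ^+ n * x \in R -> w ^+ m * x \in R.
Proof.
move=> /subnKC <- Rx; have [_ XX _ _] := normalizingX (n - m) Nw.
suff -> : w ^+ m * x = w' ^+ (n - m) * (w ^+ (m + (n - m)) * x).
  by rewrite rpredM// generator_mem.
by rewrite addnC exprD !mulrA XX mul1r.
Qed.

(* The residues of the right kernel of a unit c of A in the P-adic            *)
(* completion of R, for varying c, form an ideal of the residue ring by the   *)
(* Ore condition. It is proper because c is not in every power of P.          *)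
Lemma completion_kernel c g r : c \in R -> c * g = 1 -> g * c = 1 -> r \in R ->
  (forall n, exists p, P p /\ w ^+ n * (c * (r + p)) \in R) -> phi r = 0.
Proof.
move=> Rc cg gc Rr cr; apply: contrapT => r0.
pose S := [set x | x \in R /\ exists c g, [/\ c \in R, c * g = 1, g * c = 1 &
  forall n, exists p, P p /\ w ^+ n * (c * (x + p)) \in R]].
have invM (x x' y y' : A) : x * x' = 1 -> x' * x = 1 -> y * y' = 1 -> y' * y = 1 ->
    x * y * (y' * x') = 1 /\ y' * x' * (x * y) = 1.
  move=> xx' x'x yy' y'y.
  by rewrite mulrA -(mulrA x) yy' mulr1 mulrA -(mulrA y') x'x mulr1.
have [|||s [u [[Rs [d [h [Rd dh hd ds]]]] s1 Ru us su]]] := @res_bimodule_unit S _ _.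
- by move=> x [].
- split; first split.
  + split; first exact: rpred0.
    exists 1, 1; rewrite rpred1 mul1r; split=> // n; exists 0; rewrite addr0 !mulr0.
    by split; [exact: additive0 rad_additive | exact: rpred0].
  + move=> x y [Rx [c1 [g1 [Rc1 cg1 gc1 H1]]]] [Ry [c2 [g2 [Rc2 cg2 gc2 H2]]]].
    split; first exact: rpredB.
    (* The common left multiple [c' c1 = s' c2] serves as a witness for both [x] and [y]. *)
    have [c' [g' [s' [Rc' cg' gc' Rs' E]]]] := ore Rc2 cg2 gc2 Rc1.
    have [i1 i2] := invM _ _ _ _ cg' gc' cg1 gc1.
    exists (c' * c1), (g1 * g'); split=> [|//|//|n]; first exact: rpredM.
    have [p [Pp Hp]] := H1 n; have [q [Pq Hq]] := H2 n.
    exists (p - q); split; first exact: (additiveB rad_additive).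
    have -> : x - y + (p - q) = (x + p) - (y + q) by rewrite opprD addrACA.
    have Nn := normalizingX n Nw.
    rewrite !mulrBr {2}E -!(mulrA c') -!(mulrA s').
    by rewrite rpredB//; apply: (normalizing_mull Nn).
  + move=> t x Rt [Rx [c1 [g1 [Rc1 cg1 gc1 H1]]]]; split; split; try exact: rpredM.
      have [c' [g' [s' [Rc' cg' gc' Rs' E]]]] := ore Rc1 cg1 gc1 Rt.
      exists c', g'; split=> // n; have [p [Pp Hp]] := H1 n.
      exists (t * p); split; first exact: radMl.
      rewrite -mulrDr mulrA E -mulrA.
      exact: (normalizing_mull (normalizingX n Nw)).
    exists c1, g1; split=> // n; have [p [Pp Hp]] := H1 n.
    exists (p * t); split; first exact: radMr.
    by rewrite -mulrDl !mulrA rpredM// -mulrA.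
- by exists r => //; split=> //; exists c, g.
have [|n /negP] := @sepP d.
  by move=> d0; move: dh; rewrite d0 mul0r => /esym/eqP; rewrite oner_eq0.
apply; have [p [Pp Hp]] := ds n; have Rp := rad_sub Pp.
have [|v [Rv _ spv]] := @res_unit _ _ _ _ _ hR (s + p) (rpredD Rs Rp).
  by rewrite phiD// (radE Pp) addr0.
suff <- : w ^+ n * (d * (s + p)) * v = w ^+ n * d by rewrite rpredM.
by rewrite -!mulrA spv mulr1.
Qed.

(** The residues of the [r] with [c r] in [P^n] form a descending chain of right ideals. A residue
    in its stable term satisfies the hypothesis of [completion_kernel], so that term is zero; the
    Dubrovin condition for [g * w' ^+ N] then excludes a denominator. *)
Lemma unit_denominator c g : c \in R -> c * g = 1 -> g * c = 1 ->
  exists n, g * w' ^+ n \in R.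
Proof.
move=> Rc cg gc.
pose X n := phi @` [set r | r \in R /\ w ^+ n * (c * r) \in R].
have [n|n|N stable] := hQ.2.2 X.
- apply: res_right_ideal; first by move=> r [].
  + split; first by rewrite /= !mulr0 rpred0.
    by move=> x y [Rx cx] [Ry cy]; split; rewrite ?mulrBr rpredB.
  + move=> r x Rr [Rx cx]; split; first exact: rpredM.
    by rewrite !mulrA rpredM// -mulrA.
- move=> _ [r [Rr cr] <-]; exists r => //; split=> //.
  exact: generator_antitone cr.
have kerN r : r \in R -> w ^+ N * (c * r) \in R -> phi r = 0.
  move=> Rr cr; apply: (completion_kernel Rc cg gc Rr) => n.
  have [nN|/ltnW Nn] := leqP n N.
    exists 0; rewrite addr0; split; first exact: additive0 rad_additive.
    exact: generator_antitone cr.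
  have : X N (phi r) by exists r.
  rewrite -(stable n Nn) => -[s [Rs cs] sr].
  exists (s - r); rewrite [r + _]addrC subrK; split=> //.
  by apply: radI; rewrite ?rpredB// resB// sr subrr.
exists N; apply: contrapT => /negP /(res_dubrovin_r hR)[r [Rr Rgr]]; apply.
apply: kerN => //; have [XX _ _ _] := normalizingX N Nw.
by rewrite !mulrA -(mulrA _ c) cg mulr1 XX mul1r.
Qed.

Lemma generator_bound a : exists n, w' ^+ n * a \in R.
Proof.
have [c [z [cz zc Rc Rca _]]] := bezout a.
have [n Rzn] := unit_denominator Rc cz zc; exists n.
have [_ XX _ Rn] := normalizingX n Nw.
have := Rn _ Rzn; rewrite mulrA -[_ * _ * w ^+ n]mulrA XX mulr1 => Rnz.
suff <- : w' ^+ n * z * (c * a) = w' ^+ n * a by rewrite rpredM.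
by rewrite mulrA -(mulrA _ z) zc mulr1.
Qed.

(** Take [n] maximal with [w^n v I] inside [R]; separation, applied to one nonzero element, bounds
    [n]. For [u = w^n v], maximality means that [u I] is not inside [P], so [u I] contains a unit of
    [R] and [I] contains [u']. *)
Lemma bounded_bimodule_principal (I : set A) v v' : bimodule R I ->
  (exists2 x, I x & x <> 0) -> normalizing v v' -> (forall x, I x -> v * x \in R) ->
  exists u u', normalizing u u' /\ I = [set y | u * y \in R].
Proof.
move=> [aI mI] [x0 Ix0 x00] Nv vI; have [vv' v'v _ _] := Nv.
pose B n := `[< forall x, I x -> w ^+ n * (v * x) \in R >].
have [|m nm] := @sepP (v * x0).
  by move=> vx; apply: x00; rewrite -[x0]mul1r -v'v -mulrA vx mulr0.
have [||n /asboolP Bn maxn] := @ex_maxnP B m.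
- by exists 0%N; apply/asboolP => x Ix; rewrite mul1r; exact: vI.
- move=> n /asboolP Bn; rewrite leqNgt; apply/negP => /ltnW mn.
  by move: nm; rewrite (generator_antitone mn)//; exact: Bn.
pose u := w ^+ n * v; pose u' := v' * w' ^+ n.
have Nu : normalizing u u' by apply: normalizingM => //; exact: normalizingX.
have [uu' u'u Ru Ru'] := Nu.
have uI x : I x -> u * x \in R by move=> Ix; rewrite -mulrA; exact: Bn.
have [x Ix ux0] : exists2 x, I x & phi (u * x) <> 0.
  apply: contrapT => nox; suff : (n.+1 <= n)%N by rewrite ltnn.
  apply: maxn; apply/asboolP => x Ix; rewrite exprS -mulrA (mulrA _ v); apply/PE.
  apply: radI; first exact: uI.
  by apply: contrapT => ux0; apply: nox; exists x.
clearbody u u'; pose S := [set r | r \in R /\ I (u' * r)].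
have [|||s [t [[Rs Is] _ Rt _ st]]] := @res_bimodule_unit S _ _.
- by move=> r [].
- split; first split.
  + by split; [exact: rpred0 | rewrite mulr0; exact: additive0].
  + move=> r s [Rr Ir] [Rs Is]; split; first exact: rpredB.
    by rewrite mulrBr; exact: additiveB.
  + move=> r s Rr [Rs Is]; split; split; try exact: rpredM.
      have -> : u' * (r * s) = u' * r * u * (u' * s).
        by rewrite -!mulrA (mulrA u) uu' mul1r.
      by have [] := mI _ _ (Ru' r Rr) Is.
    by rewrite mulrA; have [] := mI _ _ Rr Is.
- by exists (u * x) => //; split; [exact: uI | rewrite mulrA u'u mul1r].
have Iu' : I u' by rewrite -[u']mulr1 -st mulrA; have [] := mI _ _ Rt Is.
exists u, u'; split=> //; apply/seteqP; split=> [y /uI//|y /= Ruy].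
by rewrite -[y]mul1r -u'u -mulrA; have [] := mI _ _ Ruy Iu'.
Qed.

(** The denominator [c] need not be normalizing. The ideal [J] of all denominators of [I] in [R] is
    covered by the previous lemma with [v = 1], and its generator is a normalizing denominator. *)
Lemma bimodule_principal (I : set A) c : bimodule R I ->
  (exists2 x, I x & x <> 0) -> c \in R -> c <> 0 -> (forall x, I x -> c * x \in R) ->
  exists u u', normalizing u u' /\ I = [set y | u * y \in R].
Proof.
move=> bI nI Rc c0 cI; pose J := [set r | r \in R /\ forall x, I x -> r * x \in R].
have [||||u [u' [Nu JE]]] := @bounded_bimodule_principal J 1 1.
- split; first split.
  + by split=> [|x _]; rewrite ?mul0r rpred0.
  + by move=> r s [Rr rI] [Rs sI]; split=> [|x Ix]; rewrite ?mulrBl rpredB ?rI ?sI.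
  + move=> r s Rr [Rs sI]; split; split; try exact: rpredM.
      by move=> x Ix; rewrite -mulrA rpredM ?sI.
    by move=> x Ix; rewrite -mulrA; apply: sI; have [] := bI.2 _ _ Rr Ix.
- by exists c.
- exact: normalizing1.
- by move=> x [Rx _]; rewrite mul1r.
apply: (@bounded_bimodule_principal I u' u) => //; first exact: normalizingV.
suff [] : J u' by [].
by rewrite JE /=; case: Nu => -> _ _ _; exact: rpred1.
Qed.

End Principal.

Lemma normalizing_mem t t' r : normalizing t t' -> r \in R -> t' * r \in R ->
  phi r <> 0 -> t' \in R.
Proof.
move=> [tt' t't Rt Rt'] Rr Rt'r r0.
pose S := [set s | s \in R /\ t' * s \in R].
have [|||s [u [[Rs Rt's] _ Ru _ su]]] := @res_bimodule_unit S _ _.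
- by move=> s [].
- split; first split.
  + by split; rewrite ?mulr0 rpred0.
  + by move=> x y [Rx Rt'x] [Ry Rt'y]; split; rewrite ?mulrBr rpredB.
  + move=> x y Rx [Ry Rt'y]; split; split; try exact: rpredM.
      have -> : t' * (x * y) = t' * x * t * (t' * y).
        by rewrite -!mulrA (mulrA t) tt' mul1r.
      by rewrite rpredM ?Rt'.
    by rewrite mulrA rpredM.
- by exists r.
by rewrite -[t']mulr1 -su mulrA rpredM.
Qed.

(** The source of the total order on values. If [t] is not in [R], some [t s] in [R] has nonzero
    residue, and [t'] sends it back to [s] in [R]. *)
Lemma normalizing_total t t' : normalizing t t' -> t \in R \/ t' \in R.
Proof.
move=> Nt; have [|/(res_dubrovin_r hR)[s [Rs Rts ts0]]] := boolP (t \in R); first by left.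
right; apply: (normalizing_mem Nt Rts) => //.
by have [_ t't _ _] := Nt; rewrite mulrA t't mul1r.
Qed.

Lemma normalizing_rad t t' : normalizing t t' -> P t <-> t' \notin R.
Proof.
move=> Nt; have [tt' t't _ _] := Nt; split=> [Pt|nRt'].
  by apply/negP => Rt'; apply: res_neq0; apply: radE; rewrite -t't; exact: radMl.
have Rt : t \in R by case: (normalizing_total Nt) => // Rt'; rewrite Rt' in nRt'.
apply: radI => //; apply: contrapT => t0; move/negP: nRt'; apply.
by apply: (normalizing_mem Nt Rt) => //; rewrite t't rpred1.
Qed.

(** * Consequences of the separation hypothesis *)

Section Separated.
Hypothesis sep : forall a, (forall n, pow_bimodS P n a) -> a = 0.

Lemma rad_idempotent_trivial : P `<=` P2 -> forall x, P x -> x = 0.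
Proof.
move=> PP2 x Px; apply: sep => n; elim: n x Px => // n IHn x /PP2.
move=> [m [a [b [Pa Pb ->]]]]; exists m, a, b; split=> // k.
exact: IHn.
Qed.

Lemma generator_separated w w' : normalizing w w' -> (forall a, P a <-> w * a \in R) ->
  forall a, a <> 0 -> exists n, w ^+ n * a \notin R.
Proof.
move=> [ww' w'w _ _] PE a a0; apply: contrapT => allR; apply: a0; apply: sep => n.
(* The exponent is [n.+1] because [pow_bimodS P n] is [P ^ n.+1]. *)
have : w ^+ n.+1 * a \in R by apply: contrapT => /negP ne; apply: allR; exists n.+1.
elim: n a {allR} => [|n IHn] a; first by move/PE.
rewrite exprSr -mulrA => /IHn Pwa; rewrite -[a]mul1r -w'w -mulrA.
by apply: mul_bimodM => //; apply/PE; rewrite ww' rpred1.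
Qed.

Lemma fractional_normalizing (I : set A) c : bimodule R I ->
  (exists2 x, I x & x <> 0) -> c \in R -> c <> 0 -> (forall x, I x -> c * x \in R) ->
  exists w w', normalizing w w' /\ I = [set y | w * y \in R].
Proof.
move=> bI nI Rc c0 cI; have [PP2|/rad_generator[w [w' [Nw PE]]]] := pselect (P `<=` P2).
  have RA := rad_trivial_full (rad_idempotent_trivial PP2).
  exists 1, 1; split; first exact: normalizing1.
  have I1 : I 1.
    apply: (two_sided_ideal_full hA.1) nI; split; split; try exact: bI.1;
    by move=> r x Ix; have [] := bI.2 _ _ (RA r) Ix.
  apply/seteqP; split=> x _; first exact: RA.
  rewrite -[x]mulr1.
  by have [] := bI.2 _ _ (RA x) I1.
exact: (bimodule_principal Nw PE (generator_separated Nw PE) bI nI Rc c0 cI).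
Qed.

Lemma principal_denominator a : exists c, [/\ c \in R, c <> 0 &
  forall r, r \in R -> c * (r * a) \in R].
Proof.
have [PP2|/rad_generator[w [w' [Nw PE]]]] := pselect (P `<=` P2).
  have RA := rad_trivial_full (rad_idempotent_trivial PP2).
  by exists 1; split=> //; apply/eqP; rewrite oner_neq0.
have [n Rna] := generator_bound Nw PE (generator_separated Nw PE) a.
have Nn := normalizingX n (normalizingV Nw); have [XX _ _ _] := Nn.
exists (w' ^+ n); split; first exact: (generator_mem Nw PE).
  by move=> X0; move: XX; rewrite X0 mul0r => /esym/eqP; rewrite oner_eq0.
by move=> r Rr; exact: normalizing_mull Nn Rr Rna.
Qed.

End Separated.

End Residue.

Lemma dubrovin_residue (A : nzRingType) (R : subringClosed A) :
  dubrovin_valuation_ring R ->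
  exists Q phi, @residue_map A Q R (jrad R) phi.
Proof.
move=> [[Q [pi [pi_surj piJ]] hQ] dub].
(* Elements outside [R] are sent to the default [pi 0]. *)
pose phi a := pi (insubd (0 : subring R) a).
have phiE (x : subring R) : phi (\val x) = pi x by rewrite /phi valKd.
have lift x : x \in R -> exists y : subring R, x = \val y.
  by move=> Rx; exists (Sub x Rx); rewrite SubK.
have jradE (x : subring R) : jrad R (\val x) <-> pi x = 0.
  rewrite /jrad -piJ; split=> [[y /= y0 /val_inj <-//]|x0].
  by exists x.
exists Q, phi; split=> //.
- by move=> _ _ /lift[x ->] /lift[y ->]; rewrite -rmorphD !phiE rmorphD.
- by move=> _ _ /lift[x ->] /lift[y ->]; rewrite -rmorphM !phiE rmorphM.
- by rewrite -[1]/(\val (1 : subring R)) phiE rmorph1.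
- by move=> t; have [x <-] := pi_surj t; exists (\val x); [exact: valP | exact: phiE].
- move=> x; split=> [[y Jy <-]|[/lift[y ->]]].
    by split; [exact: valP | rewrite phiE; apply/jradE; exists y].
  by rewrite phiE => /jradE.
- move=> _ /lift[x ->]; rewrite phiE => x1.
  have [|u u1 u2] := @jacobson_unit (subring R) (1 - x).
    by rewrite -piJ /= rmorphB rmorph1 x1 subrr.
  rewrite opprB addrC subrK in u1 u2.
  exists (\val u); split; first exact: valP.
    by rewrite -rmorphM u1 rmorph1.
  by rewrite -rmorphM u2 rmorph1.
- move=> q /dub[[r Rr [Rrq nJ]] _]; exists r; split=> // rq0; apply: nJ.
  by move: Rrq rq0 => /lift[x ->]; rewrite phiE => /jradE.
- move=> q /dub[_ [r Rr [Rqr nJ]]]; exists r; split=> // qr0; apply: nJ.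
  by move: Rqr qr0 => /lift[x ->]; rewrite phiE => /jradE.
Qed.

(** * The value group *)

Section Values.
Variables (A Q : nzRingType) (R : subringClosed A) (phi : A -> Q).
Hypothesis hA : simple_artinian A.
Hypothesis hR : residue_map R (jrad R) phi.
Hypothesis sep : forall a, (forall n, pow_bimodS (jrad R) n a) -> a = 0.
Local Notation P := (jrad R).

(* The bimodule M u is w' R = R w' for u = (w, w'); multiplication is         *)
(* arranged so that M (u v) = M u M v.                                        *)
Definition unit_pair := {u : A * A | normalizing R u.1 u.2}.
Implicit Types u v t : unit_pair.

Definition pair_one : unit_pair := exist _ (1, 1) (normalizing1 R).
Definition pair_mul u v : unit_pair :=
  exist _ ((sval v).1 * (sval u).1, (sval u).2 * (sval v).2)
    (normalizingM (svalP v) (svalP u)).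
Definition pair_inv u : unit_pair :=
  exist _ ((sval u).2, (sval u).1) (normalizingV (svalP u)).

Definition pair_bimod u : set A := [set y | (sval u).1 * y \in R].
Local Notation M := pair_bimod.

Lemma pair_bimod_bimodule u : bimodule R (M u).
Proof.
split; first split; rewrite /M /=; first by rewrite mulr0 rpred0.
  by move=> x y Rx Ry; rewrite mulrBr rpredB.
move=> r x Rr Rx; split; first exact: normalizing_mull (svalP u) Rr Rx.
by rewrite mulrA rpredM.
Qed.

Lemma pair_bimod_one : M pair_one = [set` R].
Proof. by apply/seteqP; split=> x; rewrite /M /= mul1r. Qed.

Lemma pair_bimod_mul u v : mul_bimod (M u) (M v) = M (pair_mul u v).
Proof.
case: u v => -[w w'] /= Nw [[t t'] /= Nt].
have [ww' w'w _ _] := Nw; apply/seteqP; split; last first.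
  move=> y; rewrite /M /= => Ry; rewrite -[y]mul1r -w'w -mulrA.
  by apply: mul_bimodM; rewrite /M /= ?ww' ?rpred1 // mulrA.
apply: mul_bimod_sub; first by have [] := pair_bimod_bimodule (pair_mul
  (exist _ (w, w') Nw) (exist _ (t, t') Nt)).
move=> a b; rewrite /M /= => Ra Rb.
by rewrite -mulrA (mulrA w); exact: normalizing_mull Nt Ra Rb.
Qed.

Lemma pair_bimod_subP u v : M u `<=` M v <-> (sval v).1 * (sval u).2 \in R.
Proof.
case: u v => -[w w'] /= Nw [[t t'] /= Nt]; have [ww' w'w _ _] := Nw.
rewrite /M /=; split=> [|Rtw' y /= Rwy].
  by move=> /(_ w'); rewrite /= ww' rpred1; apply.
have -> : t * y = t * w' * (w * y) by rewrite -mulrA (mulrA w') w'w mul1r.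
by rewrite rpredM.
Qed.

Lemma pair_bimod_total u v : M u `<=` M v \/ M v `<=` M u.
Proof.
case: (normalizing_total hR (normalizingM (svalP v) (normalizingV (svalP u)))) => h.
  by left; apply/pair_bimod_subP.
by right; apply/pair_bimod_subP.
Qed.

Lemma subring_neq0 (c : subring R) : regular_elt c -> \val c <> 0.
Proof.
move=> [lc _]; rewrite -[0]/(\val (0 : subring R)) => /val_inj c0.
have /lc/eqP : c * 1 = c * 0 by rewrite c0 !mul0r.
by rewrite oner_eq0.
Qed.

Lemma fractional_idealP (I : set A) : fractional_ideal R I -> exists u, I = M u.
Proof.
move=> [bI [c /subring_neq0 c0 Ic] [r /subring_neq0 r0 rI]].
have [|w [w' [Nw IE]]] := fractional_normalizing hA hR sep bI _ (valP r) r0 rI.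
  by exists (\val c).
by exists (exist _ (w, w') Nw).
Qed.

Lemma normalizing_regular w w' (Rw : w \in R) : normalizing R w w' ->
  regular_elt (Sub w Rw : subring R).
Proof.
move=> [ww' w'w _ _]; split=> x y /(congr1 \val); rewrite !rmorphM /= => xy;
  apply: val_inj.
  by rewrite -[LHS]mul1r -[RHS]mul1r -w'w -!mulrA xy.
by rewrite -[LHS]mulr1 -[RHS]mulr1 -ww' !mulrA xy.
Qed.

Lemma pair_bimod_fractional u : fractional_ideal R (M u).
Proof.
have bM := pair_bimod_bimodule u.
case: u bM => -[w w'] /= Nw bM; have [ww' w'w _ _] := Nw.
have reg1 : regular_elt (1 : subring R) by split=> x y; rewrite ?mul1r ?mulr1.
split=> //.
  have [Rw|Rw'] := normalizing_total hR Nw.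
    by exists 1 => //; rewrite /M /= mulr1.
  exists (Sub w' Rw'); first exact: normalizing_regular (normalizingV Nw).
  by rewrite /M /= ww' rpred1.
have [Rw|Rw'] := normalizing_total hR Nw.
  by exists (Sub w Rw) => //; exact: normalizing_regular Nw.
exists 1 => // x; rewrite /M /= mul1r => Rwx.
by rewrite -[x]mul1r -w'w -mulrA rpredM.
Qed.

Lemma principal_bimod_fractional a : a <> 0 ->
  fractional_ideal R (principal_bimod R a).
Proof.
move=> a0; have [c [Rc c0 ca]] := principal_denominator hA hR sep a.
have bI := principal_bimod_bimodule R a.
have [||w [w' [Nw ->]]] := fractional_normalizing hA hR sep bI _ Rc c0.
- by exists a => //; exact: principal_bimod_gen.
- apply: (@principal_bimod_sub _ _ _ [set x | c * x \in R]).
    split; first by rewrite /= mulr0 rpred0.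
    by move=> s t /= Rs Rt; rewrite mulrBr rpredB.
  by move=> r s Rr Rs; rewrite /= mulrA rpredM// ca.
exact: (pair_bimod_fractional (exist _ (w, w') Nw)).
Qed.

Lemma pair_colonP u : colonP R (M u) = [set a | P (a * (sval u).2)].
Proof.
case: u => -[w w'] /= Nw; have [ww' w'w _ _] := Nw; apply/seteqP; split=> a /=.
  by apply; rewrite /M /= ww' rpred1.
move=> Paw' x; rewrite /M /= => Rwx.
have -> : a * x = a * w' * (w * x) by rewrite -mulrA (mulrA w') w'w mul1r.
exact: (radMr hR).
Qed.

Lemma colonP_antitone (I J : set A) : I `<=` J -> colonP R J `<=` colonP R I.
Proof. by move=> IJ a aJ x /IJ; exact: aJ. Qed.

(** The hypothesis says [P x] lies in [P] for [x = w t']. If [x] were not in [R], its inverse would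
    lie in [P], so each [p = (p x) x^(-1)] would be in [P^2]. Then [P = 0] by separation, and the
    inverse of [x] would vanish. *)
Lemma pair_colonP_sub u v : colonP R (M u) `<=` colonP R (M v) -> M v `<=` M u.
Proof.
rewrite !pair_colonP => sub; apply/pair_bimod_subP.
case: u v sub => -[w w'] /= Nw [[t t'] /= Nt] sub.
have Nwt' := normalizingM Nw (normalizingV Nt); have [ww' w'w _ _] := Nw.
have PPwt' p : P p -> P (p * (w * t')).
  by move=> Pp; rewrite mulrA; apply: sub; rewrite /= -mulrA ww' mulr1.
apply: contrapT => /negP nR; have Ptw' : P (t * w').
  by apply/(normalizing_rad hR (normalizingV Nwt')).
have [i1 i2 _ _] := Nwt'.
have PP2 : P `<=` mul_bimod P P.
  move=> p Pp; rewrite -[p]mulr1 -i1 mulrA.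
  by apply: mul_bimodM => //; exact: PPwt'.
have := rad_idempotent_trivial sep PP2 Ptw' => tw'0.
by move: i1; rewrite tw'0 mulr0 => /esym/eqP; rewrite oner_eq0.
Qed.

Definition pair_value u : value_set R :=
  value (exist _ (M u) (mem_set (pair_bimod_fractional u))).

Lemma pair_valueE u : \val (pair_value u) = colonP R (M u). Proof. by []. Qed.

Lemma pair_value_le u v : value_le (pair_value u) (pair_value v) <-> M v `<=` M u.
Proof. by split; [exact: pair_colonP_sub | exact: colonP_antitone]. Qed.

Lemma pair_value_inj u v : pair_value u = pair_value v -> M u = M v.
Proof.
by move=> uv; apply/seteqP; split; apply/pair_value_le; rewrite uv.
Qed.

Lemma value_pair (I : fractional_ideal R) u : \val I = M u -> value I = pair_value u.
Proof. by move=> IE; apply: val_inj; rewrite /= IE. Qed.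

Lemma pair_value_congr u v : M u = M v -> pair_value u = pair_value v.
Proof. by move=> uv; apply: val_inj; rewrite !pair_valueE uv. Qed.

Lemma value_setP (g : value_set R) : exists u, pair_value u = g.
Proof.
have [I /fractional_idealP[u IE] gE] := set_mem (valP g).
by exists u; apply: val_inj; rewrite pair_valueE -gE IE.
Qed.

Definition value_pair_of g : unit_pair := sval (cid (value_setP g)).

Lemma value_pair_ofK g : pair_value (value_pair_of g) = g.
Proof. exact: svalP (cid (value_setP g)). Qed.

(** Representatives are chosen; [value_addE] shows that the choice is immaterial, since a value
    determines its bimodule. *)
Definition value_add (g h : value_set R) : value_set R :=
  pair_value (pair_mul (value_pair_of g) (value_pair_of h)).

Lemma value_addE u v :
  value_add (pair_value u) (pair_value v) = pair_value (pair_mul u v).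
Proof.
apply: pair_value_congr; rewrite -!pair_bimod_mul.
by congr mul_bimod; apply: pair_value_inj; exact: value_pair_ofK.
Qed.

Lemma value_po_semigroup :
  po_semigroup value_add (pair_value pair_one) (@value_le A R).
Proof.
split.
- move=> g h k; have [u <-] := value_setP g; have [v <-] := value_setP h.
  have [t <-] := value_setP k; rewrite !value_addE; apply: pair_value_congr.
  by rewrite /M /= mulrA.
- move=> g; have [u <-] := value_setP g; rewrite value_addE.
  by apply: pair_value_congr; rewrite /M /= mulr1.
- move=> g; have [u <-] := value_setP g; rewrite value_addE.
  by apply: pair_value_congr; rewrite /M /= mul1r.
- split; first by move=> g x.
    by move=> g h gh hg; apply: val_inj; apply/seteqP.
  by move=> g h k gh hk; exact: subset_trans gh hk.
- move=> g h k; have [u <-] := value_setP g; have [v <-] := value_setP h.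
  have [t <-] := value_setP k; rewrite !value_addE => /pair_value_le vu.
  split; apply/pair_value_le; rewrite -!pair_bimod_mul => _ [n [a [b [Ha Hb ->]]]];
    exists n, a, b; split=> // i; exact: vu.
Qed.

Lemma value_totally_ordered :
  totally_ordered_group value_add (pair_value pair_one) (@value_le A R).
Proof.
split; first exact: value_po_semigroup.
  move=> g; have [u <-] := value_setP g; exists (pair_value (pair_inv u)).
  have [ww' w'w _ _] := svalP u.
  by rewrite !value_addE; split; apply: pair_value_congr; rewrite /M /= ?ww' ?w'w.
move=> g h; have [u <-] := value_setP g; have [v <-] := value_setP h.
by case: (pair_bimod_total u v) => ?; [right | left]; apply/pair_value_le.
Qed.

Lemma value_arithmetical :
  arithmetical_pseudo_valuation value_add (pair_value pair_one) (@value_le A R)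
    (@value A R).
Proof.
have add_sub (I J : set A) : additive_subgroup I -> additive_subgroup J ->
    I `<=` J -> add_bimod I J = J.
  move=> aI aJ IJ; apply/seteqP; split=> [_ [a [b [Ia Jb ->]]]|b Jb].
    by apply: (additiveD aJ) => //; exact: IJ.
  by exists 0, b; rewrite add0r; split=> //; exact: additive0.
have addC (I J : set A) : add_bimod I J = add_bimod J I.
  by apply/seteqP; split=> _ [a [b [Ia Jb ->]]]; exists b, a; rewrite addrC.
split; first exact: value_po_semigroup; split.
- move=> I J; have [u IE] := fractional_idealP (set_mem (valP I)).
  have [v JE] := fractional_idealP (set_mem (valP J)).
  exists (exist _ (M (pair_mul u v)) (mem_set (pair_bimod_fractional _))).
    by rewrite /= IE JE pair_bimod_mul.
  by rewrite (value_pair IE) (value_pair JE) value_addE.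
- move=> I J; have [u IE] := fractional_idealP (set_mem (valP I)).
  have [v JE] := fractional_idealP (set_mem (valP J)).
  have au := (pair_bimod_bimodule u).1; have av := (pair_bimod_bimodule v).1.
  (* The sum of two comparable bimodules is the larger one, which has the smaller value. *)
  case: (pair_bimod_total u v) => [uv|vu].
    by exists J => //; rewrite IE JE add_sub.
  by exists I => //; rewrite IE JE addC add_sub.
- exists (exist _ (M pair_one) (mem_set (pair_bimod_fractional _))) => //.
  exact: pair_bimod_one.
- by move=> I J; exact: colonP_antitone.
Qed.

Lemma value_one : \val (pair_value pair_one) = P.
Proof.
by rewrite pair_valueE pair_colonP; apply/seteqP; split=> a /=; rewrite mulr1.
Qed.

Lemma principal_bimod_pair a : a <> 0 -> exists (I : fractional_ideal R) u,
  [/\ \val I = principal_bimod R a, principal_bimod R a = M u &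
      value I = pair_value u].
Proof.
move=> a0; have fa := principal_bimod_fractional a0.
have [u uE] := fractional_idealP fa.
by exists (exist _ (principal_bimod R a) (mem_set fa)), u; split=> //; apply: value_pair.
Qed.

Lemma value_ge0 u :
  value_le (pair_value pair_one) (pair_value u) <-> (sval u).2 \in R.
Proof. by rewrite pair_value_le pair_bimod_subP /= mul1r. Qed.

Lemma value_gt0 u :
  value_lt (pair_value pair_one) (pair_value u) <-> P (sval u).2.
Proof.
have Nu := svalP u; have [ww' w'w _ _] := Nu.
rewrite (normalizing_rad hR (normalizingV Nu)); split=> [[le01 ne]|nRw].
  apply/negP => Rw; apply: ne; apply: pair_value_congr; apply/seteqP; split.
    by apply/pair_bimod_subP; rewrite mulr1.
  by apply/pair_value_le.
have Rw' : (sval u).2 \in R.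
  by case: (normalizing_total hR Nu) => // Rw; rewrite Rw in nRw.
split; first exact/value_ge0.
move=> E; have := pair_value_inj E => /seteqP[/pair_bimod_subP + _].
by rewrite /= mulr1; exact/negP.
Qed.

(** [a] and [w'] generate the same bimodule, so a bimodule contains both or neither. *)
Lemma principal_bimod_eq_pair (S : set A) a u : bimodule R S ->
  principal_bimod R a = M u -> S a <-> S (sval u).2.
Proof.
move=> [aS mS] aE; have [ww' w'w _ _] := svalP u; split=> [Sa|Sw'].
  have : M u (sval u).2 by rewrite /M /= ww' rpred1.
  rewrite -aE; apply: principal_bimod_sub => // r s Rr Rs.
  by have [_] := mS _ _ Rs (mS _ _ Rr Sa).1.
have : M u a by rewrite -aE; exact: principal_bimod_gen.
rewrite /M /= => Rwa; rewrite -[a]mul1r -w'w -mulrA.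
by have [] := mS _ _ Rwa Sw'.
Qed.

(** Serves both descriptions in the theorem: [S] is [P] or [R], and [lt] is positivity or
    nonnegativity. The element 0 is treated apart because [R 0 R] contains no regular element. *)
Lemma value_characterization (S : set A) (lt : value_set R -> Prop) :
  bimodule R S -> (forall u, lt (pair_value u) <-> S (sval u).2) ->
  S = [set a | a = 0 \/ exists2 I : fractional_ideal R,
    \val I = principal_bimod R a & lt (value I)].
Proof.
move=> bS ltE; apply/seteqP; split=> a.
  move=> Sa; have [a0|a0] := pselect (a = 0); [by left | right].
  have [I [u [Ia aE Iu]]] := principal_bimod_pair a0.
  by exists I; rewrite // Iu; apply/ltE/(principal_bimod_eq_pair bS aE).
move=> [->|[I Ia]]; first exact: additive0 bS.1.
have [u IE] := fractional_idealP (set_mem (valP I)).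
rewrite (value_pair IE) => /ltE.
by move: IE; rewrite Ia => IE /(principal_bimod_eq_pair bS IE).
Qed.

End Values.

Theorem proposition4p4 (A : nzRingType) (R : subringClosed A)
  (hA : simple_artinian A)
  (hR : dubrovin_valuation_ring R)
  (hP : \bigcap_n pow_bimodS (jrad R) n = [set 0]) :
  exists (add : value_set R -> value_set R -> value_set R)
         (zero : value_set R),
    [/\ \val zero = jrad R,
        arithmetical_pseudo_valuation add zero (@value_le A R) (@value A R),
        totally_ordered_group add zero (@value_le A R),
        (forall a : A, a <> 0 -> fractional_ideal R (principal_bimod R a)) &
        jrad R =
          [set a | a = 0 \/
             exists2 I : fractional_ideal R,
               \val I = principal_bimod R a & value_lt zero (value I)] /\
        [set` R] =
          [set a | a = 0 \/
             exists2 I : fractional_ideal R,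
               \val I = principal_bimod R a & value_le zero (value I)]].
Proof.
have [Q [phi res]] := dubrovin_residue hR.
have sep a : (forall n, pow_bimodS (jrad R) n a) -> a = 0.
  by move=> Pa; have : [set 0 : A] a by rewrite -hP => n _; exact: Pa.
exists (value_add hA res sep), (pair_value res (pair_one R)); split.
- exact: value_one.
- exact: value_arithmetical.
- exact: value_totally_ordered.
- by move=> a; exact: principal_bimod_fractional hA res sep a.
split.
- apply: (value_characterization hA sep (hR := res) (lt := value_lt _)).
    exact: rad_bimodule res.
  by move=> u; exact: value_gt0.
- apply: (value_characterization hA sep (hR := res) (lt := value_le _)).
    by rewrite -pair_bimod_one; exact: pair_bimod_bimodule.
  by move=> u; exact: value_ge0.
Qed.
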